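(* Let $2\le q\le p<\infty$, let $\Omega\subset\mathbb{R}^d$ be compact with a probability measure $\mu$, and let $X_N\subset\mathcal{C}(\Omega)$ be an $N$-dimensional subspace satisfying $$\|f\|_\infty\le BN^{1/q}\|f\|_q\quad\text{for all } f\in X_N$$ with $B\ge1$. Then for any $\epsilon\in(0,1)$ there is a large enough constant $C=C(p,q,\epsilon)$ (depending only on $p,q,\epsilon$) such that there exist $$m\le CB^pN^{p/q}(\log_2(2BN))^3$$ points $\xi^j\in\Omega$, $j=1,\dots,m$, such that for any $f\in X_N$ $$(1-\epsilon)\|f\|_p^p\le\frac1m\sum_{j=1}^m|f(\xi^j)|^p\le(1+\epsilon)\|f\|_p^p.$$
   Context: $\mathcal{C}(\Omega)$ is the space of continuous functions on $\Omega$. For $1\le p<\infty$, $\|f\|_p:=\left(\int_\Omega|f|^p\,d\mu\right)^{1/p}$, and $\|f\|_\infty:=\max_{\mathbf{x}\in\Omega}|f(\mathbf{x})|$. The points $\xi^1,\dots,\xi^m$ form a finite family; repetitions are allowed. *)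

(* Defs.v *)
From HB Require Import structures.
From mathcomp Require Import all_boot all_order all_algebra.
From mathcomp Require Import all_classical all_reals all_analysis.

Set Implicit Arguments.
Unset Strict Implicit.
Unset Printing Implicit Defensive.

Import Order.TTheory GRing.Theory Num.Theory.
Import numFieldNormedType.Exports.

Local Open Scope classical_set_scope.
Local Open Scope ring_scope.

(* [set_type Om] is not canonically pointed, whereas [measurableType] requires
   a point. [subset_at x0] is the subtype [Om] with its induced topology and
   the point [x0]. The topology and the Borel sigma-algebra do not depend on
   [x0]. *)
Definition subset_at (T : topologicalType) (Om : set T) (x0 : Om) : Type := Om.

HB.instance Definition _ (T : topologicalType) (Om : set T) (x0 : Om) :=
  Topological.on (@subset_at T Om x0).
HB.instance Definition _ (T : topologicalType) (Om : set T) (x0 : Om) :=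
  isPointed.Build (@subset_at T Om x0) x0.

Notation borel T := (g_sigma_algebraType (@open T)).

Definition log2 (R : realType) (x : R) : R := ln x / ln 2.

(* The library's ['N[mu]_+oo] is an essential supremum, so the uniform norm is
   defined separately. The supremum is a maximum for continuous [f] on a
   nonempty compact space. *)
Definition supnorm (R : realType) (T : Type) (f : T -> R) : R :=
  sup (range (fun x => `|f x|)).

Definition Lpnorm (R : realType) d (T : measurableType d)
    (mu : probability T R) (p : R) (f : T -> R) : \bar R :=
  'N[mu]_(p%:E)[EFin \o f].

Definition linearly_independent (R : realType) (V : lmodType R) (N : nat)
    (phi : 'I_N -> V) : Prop :=
  forall c : 'I_N -> R, \sum_(i < N) c i *: phi i = 0 -> forall i, c i = 0.

Definition spans (R : realType) (V : lmodType R) (N : nat)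
    (phi : 'I_N -> V) (X : set V) : Prop :=
  forall f, X f -> exists c : 'I_N -> R, f = \sum_(i < N) c i *: phi i.

Definition linear_subspace (R : realType) (V : lmodType R) (X : set V) : Prop :=
  X 0 /\ forall (a : R) (u v : V), X u -> X v -> X (a *: u + v).

Definition has_dim (R : realType) (V : lmodType R) (X : set V) (N : nat)
    : Prop :=
  exists phi : 'I_N -> V,
    [/\ forall i, X (phi i), linearly_independent phi & spans phi X].

(* Main.v *)
Require Import Defs.
From mathcomp Require Import all_boot all_order all_algebra.
From mathcomp Require Import all_classical all_reals all_analysis.
From mathcomp Require Import measurable_realfun.
From mathcomp Require Import ring lra zify.
Import Order.TTheory GRing.Theory Num.Theory.
Import numFieldNormedType.Exports.
Local Open Scope classical_set_scope.
Local Open Scope ring_scope.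

(** Put [W = B ^ p * N ^ (p / q)] and let [K] consist of the [f] in [X] whose
    [L^p] norm is at most 1. By Jensen's inequality ([power_mean_jensen]) the
    hypothesis on [X] gives [`|f| ^ p <= W] on [K]. From then on the exponent
    [q] is forgotten, and the dimension of [X] matters only through [W].

    The points are obtained without random sampling, by halving. The measure is
    replaced by the uniform measure on [2 ^ k * m] points, with [k] as large as
    necessary ([uniform_quadrature]). The family is then halved [k] times: the
    points are grouped in pairs, and one point of each pair [x_i], [y_i] is kept. The
    error of a halving is a signed sum of the differences
    [`|f x_i| ^ p - `|f y_i| ^ p], and the signs must make it small for all
    [f] in [K] at once ([halving_step]).

    For this [`|f| ^ p] is cut into dyadic layers. The layer at height [t] takes
    values in the interval from 0 to [t ^ p], so its signed sums over [n] pairs have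
    variance at most of order [t ^ p * n]. On the other hand this layer is determined,
    up to an admissible relative error [a], by [f] up to [a * t] in the maximum
    norm over the points, and [K] has about [exp (W / (a * t) ^ p * ln n)]
    elements at that scale ([sup_net]). The powers of [t] cancel, so that a
    union bound for random signs ([exists_balancing_signs]) controls each layer
    by the square root of [n * W * ln n]. The number of layers is of order [ln W]; it
    multiplies the error, hence enters the number of points squared, and together with
    [ln n] it makes up the cube of the logarithm. The errors of
    successive halvings grow geometrically towards the last one, so their sum is of
    the order of the last ([halving_rate], [subsampling]).

    The covering bound rests on uniform convexity. To learn an unknown [f] in
    [K] at the points, guess an element of almost minimal norm among the functions
    compatible with the corrections received so far. If a guess is wrong by
    [t] at a point, the next guess differs from it by at least [t] there, and
    Clarkson's inequality forces the [p]-th power of the norm to grow by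
    [(t / 2) ^ p / W]. Since that power stays about 1 at most, there are at most about
    [W / (t / 2) ^ p] corrections, and their record, a word over an alphabet
    of twice as many letters as there are points, determines an approximation
    of [f]. *)

Set Implicit Arguments.
Unset Strict Implicit.

(** * Inequalities for real powers *)

(** Young's inequality for [r * 1] with exponents [p] and [p / (p - 1)]. *)
Lemma bernoulli_powR (R : realType) (p r : R) :
  1 <= p -> 0 <= r -> 1 + p * (r - 1) <= r `^ p.
Proof.
rewrite le_eqVlt => /predU1P[<-|p1] r0.
  by rewrite powRr1// mul1r subrKC.
have p0 : 0 < p by lra.
have q0 : 0 < p / (p - 1) by rewrite divr_gt0// subr_gt0.
have := conjugate_powR r0 ler01 p0 q0.
rewrite powR1 mulr1 invf_div mul1r.
have -> : p^-1 + (p - 1) / p = 1 by field; lra.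
move=> /(_ erefl).
have -> : r `^ p / p + (p - 1) / p = (r `^ p + (p - 1)) / p by field; lra.
by rewrite ler_pdivlMr// mulrC; lra.
Qed.

Lemma powR_lipschitz (R : realType) (p t d x y : R) :
  1 <= p -> 0 < t -> 0 <= x <= t -> 0 <= y <= t -> `|x - y| <= d * t ->
  `|x `^ p - y `^ p| <= p * d * t `^ p.
Proof.
move=> p1 t0; wlog yx : x y / y <= x.
  move=> H hx hy; have [/H|/ltW xy] := leP y x; first exact.
  rewrite distrC => ?; rewrite distrC; exact: H.
move=> /andP[x0 xt] /andP[y0 yt].
have p0 : 0 < p by lra.
rewrite ger0_norm ?subr_ge0// => xyd.
rewrite ger0_norm ?subr_ge0; last by rewrite ge0_ler_powR ?nnegrE// ltW.
have d0 : 0 <= d by rewrite -(pmulr_lge0 d t0); lra.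
have [x00|xn0] := eqVneq x 0.
  have y00 : y = 0 by lra.
  by rewrite x00 y00 subrr mulr_ge0 ?powR_ge0// mulr_ge0// ltW.
have {}x0 : 0 < x by rewrite lt_neqAle eq_sym xn0.
have B := bernoulli_powR p1 (divr_ge0 y0 (ltW x0)).
have yE : y `^ p = x `^ p * (y / x) `^ p.
  by rewrite -powRM ?divr_ge0 ?(ltW x0)// mulrCA divff// mulr1.
have : x `^ p - y `^ p <= p * (x `^ (p - 1) * (x - y)).
  have -> : x `^ (p - 1) * (x - y) = x `^ p * (1 - y / x).
    by rewrite -(mulr_powRB1 (ltW x0) p0); field.
  have := ler_wpM2l (powR_ge0 x p) B; rewrite -yE; lra.
move=> /le_trans; apply; rewrite -mulrA ler_pM2l//.
rewrite -(mulr_powRB1 (ltW t0) p0) mulrA [leRHS]mulrC.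
apply: ler_pM => //; rewrite ?powR_ge0 ?subr_ge0//.
by rewrite ge0_ler_powR ?nnegrE ?(ltW x0) ?(ltW t0)// subr_ge0.
Qed.

Lemma powR_superadditive (R : realType) (r x y : R) :
  1 <= r -> 0 <= x -> 0 <= y -> x `^ r + y `^ r <= (x + y) `^ r.
Proof.
move=> r1 x0 y0; have r0 : 0 < r by lra.
have [s0|sn0] := eqVneq (x + y) 0.
  have -> : x = 0 by lra.
  have -> : y = 0 by lra.
  by rewrite addr0 powR0 ?gt_eqF// addr0.
have s0 : 0 < x + y by rewrite lt_neqAle eq_sym sn0 addr_ge0.
suff H z : 0 <= z <= x + y -> z `^ r <= z / (x + y) * (x + y) `^ r.
  apply: (le_trans (lerD (H x _) (H y _))); [lra|lra|].
  by rewrite -mulrDl -mulrDl divff// mul1r.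
move=> /andP[z0 zs].
have [->|zn0] := eqVneq z 0; first by rewrite powR0 ?gt_eqF// !mul0r.
rewrite -{1}(divfK sn0 z) ge1r_powRZ// ?(ltW s0)//.
by rewrite ler_pdivrMr// mul1r zs andbT divr_gt0// lt_neqAle eq_sym zn0.
Qed.

Lemma powR_midpoint (R : realType) (r x y : R) :
  1 <= r -> 0 <= x -> 0 <= y ->
  ((x + y) / 2) `^ r <= (x `^ r + y `^ r) / 2.
Proof.
move=> r1 x0 y0.
have h01 : (0 : R) <= 2^-1 by lra.
have h1 : (2^-1 : R) <= 1 by lra.
have := @convex_powR R r r1 (Itv01 h01 h1) x y.
rewrite !inE /= !in_itv/= !andbT => /(_ x0 y0).
rewrite [X in _ <= X]convRE [X in X `^ _]convRE /=.
have -> : unstable.onem 2^-1 = 2^-1 :> R by rewrite /unstable.onem; lra.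
by rewrite -!mulrDr mulrC [2^-1 * (_ `^ _ + _)]mulrC.
Qed.

(** This is where [2 <= p] is needed: superadditivity and
    midpoint convexity are applied to the power [p / 2 >= 1] of squares, for
    which the parallelogram law is an identity. *)
Lemma clarkson (R : realType) (p u v : R) : 2 <= p ->
  `|(u + v) / 2| `^ p + `|(u - v) / 2| `^ p <= (`|u| `^ p + `|v| `^ p) / 2.
Proof.
move=> p2; have p1 : 1 <= p / 2 by lra.
have sq (w : R) : `|w| `^ p = (w ^+ 2) `^ (p / 2).
  by rewrite -[w ^+ 2]ger0_norm ?sqr_ge0// normrX -powR_mulrn// -powRrM mulrC divfK.
rewrite !sq.
apply: le_trans (powR_superadditive p1 (sqr_ge0 _) (sqr_ge0 _)) _.
have -> : ((u + v) / 2) ^+ 2 + ((u - v) / 2) ^+ 2 = (u ^+ 2 + v ^+ 2) / 2 by field.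
exact: powR_midpoint (sqr_ge0 _) (sqr_ge0 _).
Qed.

(** * Balancing signs *)

(** The constant 2 in the exponent is four times the optimal one; with it the
    bound [expR y <= (1 - y)^-1] suffices when [x ^+ 2 <= 1 / 2], and
    [`|x| <= 2 * x ^+ 2] otherwise. *)
Lemma cosh_le (R : realType) (x : R) :
  expR x + expR (- x) <= 2 * expR (2 * x ^+ 2).
Proof.
have e1 (y : R) : y < 1 -> expR y <= (1 - y)^-1.
  move=> y1; rewrite -[y in expR y]opprK expRN lef_pV2 ?posrE ?expR_gt0 ?subr_gt0//.
  exact: expR_ge1Dx.
have [x2|x2] := leP (x ^+ 2) 2^-1.
  have xlt : `|x| < 1.
    by rewrite -(@ltr_pXn2r _ 2)// ?nnegrE// expr1n real_normK ?num_real//; lra.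
  move: (xlt); rewrite ltr_norml => /andP[x1 x3].
  have h1 := e1 _ x3; have h2 := e1 (- x) ltac:(lra).
  have h3 := expR_ge1Dx (2 * x ^+ 2).
  apply: (le_trans (lerD h1 h2)).
  have -> : (1 - x)^-1 + (1 - - x)^-1 = 2 / (1 - x ^+ 2) by field; nra.
  rewrite ler_pM2l// -[leLHS]mul1r ler_pdivrMr; [|lra].
  have : (1 + 2 * x ^+ 2) * (1 - x ^+ 2) <= expR (2 * x ^+ 2) * (1 - x ^+ 2).
    by rewrite ler_wpM2r//; lra.
  by move: (x ^+ 2) (sqr_ge0 x) x2 => y; nra.
have xh : `|x| <= 2 * x ^+ 2.
  rewrite -[x ^+ 2]real_normK ?num_real//.
  move: x2; rewrite -[x ^+ 2]real_normK ?num_real//; have := normr_ge0 x.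
  move: `|x| => y; nra.
have h1 : expR x <= expR (2 * x ^+ 2).
  by rewrite ler_expR (le_trans _ xh)// ler_norm.
have h2 : expR (- x) <= expR (2 * x ^+ 2).
  by rewrite ler_expR (le_trans _ xh)// -normrN ler_norm.
lra.
Qed.

Lemma exp_moment_signs (R : realType) (n : nat) (b : 'I_n -> R) (la : R) :
  \sum_(e : {ffun 'I_n -> bool}) expR (la * \sum_i (-1) ^+ e i * b i) <=
  2 ^+ n * expR (2 * la ^+ 2 * \sum_i b i ^+ 2).
Proof.
have -> : \sum_(e : {ffun 'I_n -> bool}) expR (la * \sum_i (-1) ^+ e i * b i) =
    \prod_(i < n) \sum_(c : bool) expR (la * ((-1) ^+ c * b i)).
  rewrite bigA_distr_bigA; apply: eq_bigr => e _.
  by rewrite mulr_sumr expR_sum.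
rewrite mulr_sumr expR_sum -[n in 2 ^+ n]card_ord -prodr_const -big_split /=.
apply: ler_prod => i _; rewrite big_bool addr_ge0 ?expR_ge0//=.
have -> : 2 * la ^+ 2 * b i ^+ 2 = 2 * (la * b i) ^+ 2 by ring.
rewrite expr1 expr0 mulN1r mul1r mulrN addrC; exact: cosh_le.
Qed.

(** Hoeffding's inequality and a union bound over [J], in counting form: if
    every sign vector failed for some [j], the exponential moments summed over
    all sign vectors and all [j] would be at least [2 ^ n]. The parameter
    [la j] minimises the bound for [j]. *)
Lemma exists_balancing_signs (R : realType) (J : finType) (n : nat)
    (b : J -> 'I_n -> R) (V : J -> R) (s : R) :
  (forall j, 0 < V j) -> (forall j, \sum_i b j i ^+ 2 <= V j) -> 0 <= s ->
  \sum_j 2 * expR (- (s ^+ 2 / (8 * V j))) < 1 ->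
  exists e : 'I_n -> bool, forall j, `|\sum_i (-1) ^+ e i * b j i| <= s.
Proof.
move=> V0 bV s0 small; apply: contrapT => /forallNP none.
pose la j := s / (4 * V j).
pose S j (e : {ffun 'I_n -> bool}) := \sum_i (-1) ^+ e i * b j i.
pose F j e := (expR (la j * S j e) + expR (- la j * S j e)) * expR (- (la j * s)).
have la0 j : 0 <= la j by rewrite divr_ge0// mulr_ge0// ltW.
have F0 j e : 0 <= F j e by rewrite mulr_ge0 ?addr_ge0 ?expR_ge0.
have F1 e : 1 <= \sum_j F j e.
  have /existsNP[j /negP] := none e; rewrite -ltNge => js.
  rewrite (bigD1 j)//=; apply: (@le_trans _ _ (F j e)); last first.
    by rewrite lerDl sumr_ge0.
  have h : expR (la j * s) <= expR (la j * S j e) + expR (- la j * S j e).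
    move: js; rewrite ltr_normr => /orP[|] /ltW h.
      by rewrite ler_wpDr ?expR_ge0// ler_expR ler_wpM2l.
    by rewrite ler_wpDl ?expR_ge0// ler_expR mulNr -mulrN ler_wpM2l.
  by rewrite /F expRN ler_pdivlMr ?expR_gt0// mul1r.
have : \sum_(e : {ffun 'I_n -> bool}) (1 : R) <= \sum_e \sum_j F j e.
  by apply: ler_sum => e _.
rewrite exchange_big /= sumr_const card_ffun card_bool card_ord.
have Fj j : \sum_e F j e <= 2 ^+ n * (2 * expR (- (s ^+ 2 / (8 * V j)))).
  rewrite -mulr_suml big_split /=.
  have h1 := exp_moment_signs (b j) (la j).
  have h2 := exp_moment_signs (b j) (- la j).
  rewrite sqrrN in h2.
  have h3 : expR (2 * la j ^+ 2 * \sum_i b j i ^+ 2) <= expR (s ^+ 2 / (8 * V j)).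
    rewrite ler_expR.
    have -> : s ^+ 2 / (8 * V j) = 2 * la j ^+ 2 * V j.
      by rewrite /la; field; rewrite gt_eqF.
    by rewrite ler_wpM2l// mulr_ge0 ?sqr_ge0.
  have -> : - (s ^+ 2 / (8 * V j)) = s ^+ 2 / (8 * V j) + - (la j * s).
    by rewrite /la; field; rewrite gt_eqF.
  rewrite expRD !mulrA ler_wpM2r ?expR_ge0//.
  apply: le_trans (lerD h1 h2) _.
  have : (0 : R) <= 2 ^+ n by rewrite exprn_ge0.
  by move=> h0; have := ler_wpM2l h0 h3; lra.
move=> /le_trans /(_ (ler_sum _ (fun j _ => Fj j))).
rewrite -mulr_sumr -[_ *+ _]mulr_natl mulr1 natrX leNgt.
by rewrite -[ltRHS]mulr1 ltr_pM2l ?exprn_gt0// small.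
Qed.

(** * Covering the unit ball in the uniform norm on finitely many points *)

(** [Psi] stands for the [p]-th power of the [L^p] norm. Beyond positivity,
    covering numbers depend only on the uniform convexity of this norm and on
    its comparison with the values at points. *)
Definition nikolskii_functional (R : realType) (T : Type) (p W : R)
    (X : set (T -> R^o)) (Psi : (T -> R^o) -> R) : Prop :=
  [/\ linear_subspace X,
      forall u, X u -> 0 <= Psi u,
      forall u v, X u -> X v ->
        Psi (2^-1 *: (u + v)) + Psi (2^-1 *: (u - v)) <= (Psi u + Psi v) / 2 &
      forall u x, X u -> `|u x| `^ p <= W * Psi u].

Lemma linear_subspace_midpoint (R : realType) (V : lmodType R) (X : set V) u v :
  linear_subspace X -> X u -> X v -> X (2^-1 *: (u + v)).
Proof.
move=> [X0 Xlin] Xu Xv; rewrite scalerDr; apply: (Xlin _ u) => //.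
by rewrite -[_ *: v]addr0; apply: (Xlin _ v).
Qed.

Section sup_net.
Variables (R : realType) (T : Type) (p W : R).
Variables (X : set (T -> R^o)) (Psi : (T -> R^o) -> R).
Hypothesis nik : nikolskii_functional p W X Psi.
Hypothesis W0 : 0 < W.
Hypothesis p0 : 0 < p.

(** An approximate minimiser replaces the exact one, so that neither
    completeness of [X] nor continuity of [Psi] has to be discussed. *)
Lemma near_minimizer (del : R) : 0 < del ->
  exists h : set (T -> R^o) -> (T -> R^o), forall A, A `<=` X -> A !=set0 ->
    A (h A) /\ forall v, A v -> Psi (h A) <= Psi v + del.
Proof.
move=> del0; have [_ Psi0 _ _] := nik.
pose P (A : set (T -> R^o)) u := A `<=` X -> A !=set0 ->
    A u /\ forall v, A v -> Psi u <= Psi v + del.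
suff H A : exists u, P A u by have [h hP] := choice H; exists h.
have [[AX [w Aw]]|nA] := pselect (A `<=` X /\ A !=set0); last first.
  by exists 0 => AX A0; exfalso; apply: nA.
have hi : has_inf (Psi @` A).
  by split; [exists (Psi w), w|exists 0 => _ [u /AX uX <-]; exact: Psi0].
have [_ [u Au <-] ult] := inf_adherent del0 hi.
exists u => _ _; split=> // v Av; rewrite (le_trans (ltW ult))// lerD2r.
by apply: ge_inf; [case: hi|exists v].
Qed.

Section version_space.
Variables (n : nat) (z : 'I_n -> T) (t : R) (h : set (T -> R^o) -> (T -> R^o)).

(** The functions of [X] that are compatible with a record of corrections, the
    latest one first. An entry [(i, c)] records that the guess made from the
    earlier entries was wrong by at least [t] at [z i], and [c] tells in which
    direction. *)
Fixpoint version_space (s : seq ('I_n * bool)) : set (T -> R^o) :=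
  if s is (i, c) :: s' then
    [set g | version_space s' g /\
             t <= (-1) ^+ c * (g (z i) - h (version_space s') (z i))]
  else X.

Lemma version_space_sub s : version_space s `<=` X.
Proof. by elim: s => [//|[i c] s IH] g /= [/IH]. Qed.

Lemma version_space_midpoint s u v :
  version_space s u -> version_space s v -> version_space s (2^-1 *: (u + v)).
Proof.
have [Xsub _ _ _] := nik.
elim: s => [Xu Xv|[i c] s IH] /=.
  exact: linear_subspace_midpoint.
move=> [su tu] [sv tv]; split; first exact: IH.
set w := h _ _ in tu tv *.
have -> : (2^-1 *: (u + v)) (z i) = (u (z i) + v (z i)) / 2 by rewrite mulrC.
move: tu tv; move: ((-1) ^+ c) (u _) (v _) => /= a x y; lra.
Qed.

Hypothesis t0 : 0 < t.
Let ka := (t / 2) `^ p / W.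
Hypothesis h_min : forall A, A `<=` X -> A !=set0 ->
  A (h A) /\ forall v, A v -> Psi (h A) <= Psi v + ka / 2.

Let ka0 : 0 < ka. Proof. by rewrite divr_gt0 ?powR_gt0 ?divr_gt0. Qed.

(** The old guess [u] nearly minimises [Psi] on a set that contains the new
    guess [v] and, by convexity, the midpoint of [u] and [v]. By Clarkson's
    inequality [Psi v] then exceeds [Psi u] by about
    [2 * Psi ((u - v) / 2)], and [u] and [v] differ by [t] at a point. *)
Lemma version_space_energy s f : version_space s f ->
  ka * (size s)%:R <= Psi (h (version_space s)).
Proof.
have [Xsub Psi0 Psi_clarkson Psi_nik] := nik.
have [X0 Xlin] := Xsub.
elim: s f => [|[i c] s IH] f sf.
  rewrite mulr0 Psi0//; apply: (@version_space_sub [::]).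
  by apply: (h_min (@version_space_sub _) _).1; exists f.
have [hs _] := h_min (@version_space_sub ((i, c) :: s)) (ex_intro _ f sf).
have [_ hmin] := h_min (@version_space_sub s) (ex_intro _ f sf.1).
have [hs' _] := h_min (@version_space_sub s) (ex_intro _ f sf.1).
have {IH}Iu := IH f sf.1.
move: hs hs' hmin Iu; rewrite [size _]/= -[(size s).+1%:R]natr1.
set v := h (version_space ((i, c) :: s)).
rewrite {1}/version_space -/version_space.
set u := h (version_space s) => -[sv tv] su /(_ _ (version_space_midpoint su sv)) um Iu.
have Xu := version_space_sub su; have Xv := version_space_sub sv.
have Xuv : X (2^-1 *: (u - v)).
  apply: linear_subspace_midpoint => //.
  by rewrite -scaleN1r -[_ *: v]addr0; exact: Xlin.
have cl := Psi_clarkson _ _ Xu Xv.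
have : ka <= Psi (2^-1 *: (u - v)).
  rewrite /ka ler_pdivrMr// [leRHS]mulrC (le_trans _ (Psi_nik _ (z i) Xuv))//.
  rewrite ge0_ler_powR ?nnegrE ?(ltW p0) ?divr_ge0 ?(ltW t0)//.
  have -> : (2^-1 *: (u - v)) (z i) = (u (z i) - v (z i)) / 2 by rewrite mulrC.
  rewrite normrM [`|2^-1|]ger0_norm ?invr_ge0// ler_pM2r ?invr_gt0// distrC.
  by rewrite (le_trans tv)// (le_trans (ler_norm _))// normrM normr_sign mul1r.
lra.
Qed.

Lemma version_space_size s f (D : nat) : version_space s f -> Psi f <= 1 ->
  W <= D%:R * (t / 2) `^ p -> (size s <= D)%N.
Proof.
move=> sf f1 WD; have := version_space_energy sf.
have [_ /(_ f sf) hmin] := h_min (@version_space_sub s) (ex_intro _ f sf).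
have kaD : 1 <= ka * D%:R by rewrite /ka mulrAC ler_pdivlMr// mul1r mulrC.
move=> le1; rewrite -ltnS -(ltr_nat R) -natr1 -(ltr_pM2l ka0) mulrDr mulr1.
rewrite (le_lt_trans le1)// (le_lt_trans hmin)//.
by move: ka0 kaD f1; move: ka => k; lra.
Qed.

(** A guess that is wrong somewhere can be corrected there, and the number of
    corrections is bounded, so some guess is right up to [t] everywhere. *)
Lemma version_space_terminal f (D : nat) : X f -> Psi f <= 1 ->
  W <= D%:R * (t / 2) `^ p ->
  exists2 s, (size s <= D)%N & forall i, `|f (z i) - h (version_space s) (z i)| <= t.
Proof.
move=> Xf f1 WD; apply: contrapT => none.
have step s : version_space s f -> exists x, version_space (x :: s) f.
  move=> sf; have sD := version_space_size sf f1 WD.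
  apply: contrapT => /forallNP stuck; apply: none; exists s => // i.
  rewrite leNgt; apply/negP => far; move: far.
  rewrite ltr_normr => /orP[|] /ltW far.
    by apply: (stuck (i, false)); split=> //; rewrite expr0 mul1r.
  by apply: (stuck (i, true)); split=> //; rewrite expr1 mulN1r.
have long k : exists2 s, size s = k & version_space s f.
  elim: k => [|k [s <- /step[x xs]]]; first by exists [::].
  by exists (x :: s).
have [s sD sf] := long D.+1.
by have := version_space_size sf f1 WD; rewrite sD ltnn.
Qed.

End version_space.

(** A guess is determined by the record of the corrections that led to it, so
    the records form a net. Hence the logarithm of the covering number is of
    order [W / t ^ p * ln n]. Passing from records of length at most [D] to
    tuples pads them with [None]. *)
Lemma sup_net (n : nat) (z : 'I_n -> T) (t : R) (D : nat) :
  0 < t -> W <= D%:R * (t / 2) `^ p ->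
  exists net : D.-tuple (option ('I_n * bool)) -> T -> R^o,
    forall f, X f -> Psi f <= 1 ->
      exists w, forall i, `|f (z i) - net w (z i)| <= t.
Proof.
move=> t0 WD.
have ka0 : 0 < (t / 2) `^ p / W / 2 by rewrite !divr_gt0 ?powR_gt0 ?divr_gt0.
have [h hP] := near_minimizer ka0.
exists (fun w => h (version_space z t h (pmap id w))) => f Xf f1.
have [s sD sf] := version_space_terminal z t0 hP Xf f1 WD.
have szw : size (map Some s ++ nseq (D - size s) None) == D.
  by rewrite size_cat size_map size_nseq subnKC.
exists (Tuple szw) => i /=.
have -> : pmap id (map Some s ++ nseq (D - size s) None) = s.
  rewrite pmap_cat map_pK//; elim: (D - size s)%N => [|k IH] /=; first exact: cats0.
  exact: IH.
exact: sf.
Qed.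

End sup_net.

(** * Dyadic layers of a power *)

(** The part of [`|u| ^ p] gained while [`|u|] runs through
    the interval from [t / 2] to [t]. *)
Definition layer (R : realType) (p t u : R) : R :=
  Num.min (Num.max `|u| (t / 2)) t `^ p - (t / 2) `^ p.

Section layer.
Variables (R : realType) (p : R).
Hypothesis p2 : 2 <= p.
Let p0 : 0 < p. Proof. by move: p2; lra. Qed.
Let p1 : 1 <= p. Proof. by move: p2; lra. Qed.

Let clamp_itv (t u : R) : 0 < t ->
  t / 2 <= Num.min (Num.max `|u| (t / 2)) t <= t.
Proof.
move=> t0; rewrite le_min le_max ge_min !lexx !orbT andbT /=; lra.
Qed.

Let clamp_itv' (t u : R) : 0 < t ->
  0 <= Num.min (Num.max `|u| (t / 2)) t <= t.
Proof. by move=> t0; have := clamp_itv u t0; lra. Qed.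

Lemma layer_ge0 t u : 0 < t -> 0 <= layer p t u.
Proof.
move=> t0; have /andP[h1 h2] := clamp_itv u t0.
by rewrite subr_ge0 ge0_ler_powR ?nnegrE ?(ltW p0)//; lra.
Qed.

Lemma layer_le_top t u : 0 < t -> layer p t u <= t `^ p.
Proof.
move=> t0; have /andP[h1 h2] := clamp_itv u t0.
rewrite (@le_trans _ _ (Num.min (Num.max `|u| (t / 2)) t `^ p)) ?gerBl ?powR_ge0//.
by rewrite ge0_ler_powR ?nnegrE ?(ltW p0)//; lra.
Qed.

Lemma layer_eq0 t u : 0 < t -> `|u| <= t / 2 -> layer p t u = 0.
Proof.
move=> t0 ut; rewrite /layer (max_idPr ut) min_l ?subrr//; lra.
Qed.

Lemma layer_le_powR t u : 0 < t -> layer p t u <= `|u| `^ p.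
Proof.
move=> t0; have [ut|ut] := leP `|u| (t / 2); first by rewrite layer_eq0 ?powR_ge0.
rewrite /layer (max_idPl (ltW ut)).
apply: (@le_trans _ _ (Num.min `|u| t `^ p)); first by rewrite gerBl powR_ge0.
rewrite ge0_ler_powR ?nnegrE ?(ltW p0)//; last by rewrite ge_min lexx.
by rewrite le_min normr_ge0 ltW.
Qed.

(** An error proportional to [t] in the argument is harmless at height [t], and
    it does not matter at all where [`|u|] is far below [t]. *)
Lemma layer_approx t d u v : 0 < t -> d <= 4^-1 -> `|u - v| <= d * t ->
  `|layer p t u - layer p t v| <= if t <= 4 * `|u| then p * d * t `^ p else 0.
Proof.
move=> t0 d4 uv; have dt : d * t <= 4^-1 * t by rewrite ler_pM2r.
have vu : `|v| <= `|u| + d * t.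
  by have := ler_normB u (u - v); rewrite subKr; lra.
case: ifPn => tu; last first.
  by rewrite !layer_eq0 ?subrr ?normr0//; lra.
rewrite /layer opprB addrA subrK.
apply: powR_lipschitz => //; [exact: clamp_itv'|exact: clamp_itv'|].
apply: le_trans uv; have /[!ler_norml]/andP[h1 h2] := ler_dist_dist u v.
move: `|u - v| `|u| `|v| h1 h2 => w a b h1 h2.
by case: (leP a (t / 2)) => ?; case: (leP b (t / 2)) => ?;
  case: (leP (t / 2) t) => ?; case: (leP a t) => ?; case: (leP b t) => ?;
  apply/andP; split; lra.
Qed.

Lemma powR_layers a u L : 0 < a -> `|u| <= a * 2 ^+ L ->
  `|u| `^ p = Num.min `|u| a `^ p + \sum_(l < L) layer p (a * 2 ^+ l.+1) u.
Proof.
move=> a0 uL.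
suff -> : Num.min `|u| a `^ p + \sum_(l < L) layer p (a * 2 ^+ l.+1) u =
    Num.min `|u| (a * 2 ^+ L) `^ p by rewrite min_l.
elim: L {uL} => [|L IH]; first by rewrite big_ord0 addr0 mulr1.
rewrite big_ord_recr /= addrA IH /layer exprSr mulrA.
have s0 : 0 < a * 2 ^+ L by rewrite mulr_gt0 ?exprn_gt0.
move: (a * 2 ^+ L) s0 => s s0; rewrite mulfK//.
case: (leP `|u| s) => us; last by rewrite addrC subrK.
by rewrite [Num.min s _]min_l ?[Num.min `|u| _]min_l; [rewrite subrr addr0|lra|lra].
Qed.

(** A geometric sum dominated by its largest term: this keeps the sum over all
    layers of the errors in [layer_approx] comparable to [`|u| ^ p]. *)
Lemma sum_dyadic_powR a v L : 0 < a -> 0 <= v ->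
  \sum_(l < L) (if a * 2 ^+ l.+1 <= v then (a * 2 ^+ l.+1) `^ p else 0) <=
  2 * v `^ p.
Proof.
move=> a0 v0.
have t0 l : 0 < a * 2 ^+ l by rewrite mulr_gt0 ?exprn_gt0.
have geo K : \sum_(l < K) (a * 2 ^+ l.+1) `^ p <= 2 * (a * 2 ^+ K) `^ p.
  elim: K => [|K IH]; first by rewrite big_ord0 mulr_ge0 ?powR_ge0.
  rewrite big_ord_recr /=.
  have h : 2 * (a * 2 ^+ K) `^ p <= (a * 2 ^+ K.+1) `^ p.
    rewrite exprSr mulrA [leRHS]powRM ?(ltW (t0 _))// mulrC ler_pM2l ?powR_gt0//.
    by rewrite -{1}[2]powRr1// ler_powR ?ler1n.
  by apply: le_trans (lerD IH (lexx _)) _; lra.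
elim: L => [|L IH]; first by rewrite big_ord0 mulr_ge0 ?powR_ge0.
case: (leP (a * 2 ^+ L.+1) v) => vL; last first.
  by rewrite big_ord_recr /= (lt_geF vL) addr0.
apply: (@le_trans _ _ (\sum_(l < L.+1) (a * 2 ^+ l.+1) `^ p)).
  by apply: ler_sum => l _; case: ifP => // _; rewrite powR_ge0.
apply: le_trans (geo _) _; rewrite ler_pM2l// ge0_ler_powR ?nnegrE ?(ltW p0)//.
exact: ltW.
Qed.
End layer.

(** * Halving a family of points *)

Section halving.
Variables (R : realType) (T : Type) (p W : R).
Variables (X : set (T -> R^o)) (Psi : (T -> R^o) -> R).
Hypothesis nik : nikolskii_functional p W X Psi.
Hypothesis W1 : 1 <= W.
Hypothesis p2 : 2 <= p.
Let p0 : 0 < p. Proof. by move: p2; lra. Qed.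
Let p1 : 1 <= p. Proof. by move: p2; lra. Qed.
Let W0 : 0 < W. Proof. by move: W1; lra. Qed.

Lemma layer_le_double (t u v : R) : 0 < t -> `|u - v| <= 4^-1 * t ->
  layer p t v <= 2 `^ p * `|u| `^ p.
Proof.
move=> t0 uv; have [vt|vt] := leP `|v| (t / 2).
  by rewrite layer_eq0// mulr_ge0 ?powR_ge0.
apply: le_trans (layer_le_powR p2 _ t0) _.
rewrite -powRM// ge0_ler_powR ?nnegrE ?(ltW p0) ?mulr_ge0//.
by have := ler_normB u (u - v); rewrite subKr; lra.
Qed.

(** One point is kept from each pair [lshift n i], [rshift n i], so that the
    error is a signed sum of differences. At height [t] the net has radius
    [a * t], hence about [exp (W / (a * t) ^ p * ln n)] elements, while the
    squared differences sum to at most [t ^ p * n], up to constants. The powers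
    of [t] cancel in the product, so one deviation [s] serves all layers. The
    part of [Q] that involves [L] pays for the union over the layers. *)
Lemma halving_step (n L : nat) (a s : R) (z : 'I_(n + n) -> T)
    (Q := ln ((n + n) * 2).+1%:R + ln (2 * L.+1%:R)) :
  (0 < n)%N -> 0 < a -> a <= 4^-1 ->
  W <= (a * 2 ^+ L) `^ p -> (a * 2 ^+ L) `^ p <= 2 `^ p * W ->
  0 <= s -> 64 * 4 `^ p * n%:R * W * Q <= s ^+ 2 * a `^ p ->
  (forall f, X f -> Psi f <= 1 -> \sum_i `|f (z i)| `^ p <= 4 * n%:R) ->
  exists e : 'I_n -> 'I_(n + n), forall f, X f -> Psi f <= 1 ->
    `|2 * (\sum_i `|f (z (e i))| `^ p) - \sum_i `|f (z i)| `^ p| <=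
    n%:R * a * (1 + 8 * p * 4 `^ p) + L%:R * s.
Proof.
move=> n0 a0 a4 WL LW s0 sQ zK.
pose t l := a * 2 ^+ l.+1.
have t0 l : 0 < t l by rewrite mulr_gt0 ?exprn_gt0.
have tL (l : 'I_L) : t l `^ p <= 2 `^ p * W.
  apply: le_trans LW; rewrite ge0_ler_powR ?nnegrE ?(ltW p0) ?(ltW (t0 _))//.
    by rewrite mulr_ge0 ?exprn_ge0// ltW.
  by rewrite ler_pM2l// ler_weXn2l ?ler1n.
(* The number of corrections that [sup_net] needs at radius [a * t l]. *)
pose D l := (Num.truncn (W / (a * t l / 2) `^ p)).+1.
have at0 l : 0 < a * t l by rewrite mulr_gt0.
have at20 l : 0 < (a * t l / 2) `^ p by rewrite powR_gt0 ?divr_gt0.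
have WD l : W <= (D l)%:R * (a * t l / 2) `^ p.
  by rewrite -ler_pdivrMr// ltW// truncnS_gt.
have DW (l : 'I_L) : (D l)%:R * t l `^ p <= 2 * W * 2 `^ p / a `^ p.
  have ap1 : a `^ p <= 1.
    have p11 : 1 `^ p = 1 :> R by rewrite powR1.
    rewrite -[leRHS]p11 ge0_ler_powR ?nnegrE ?(ltW p0) ?(ltW a0)//; lra.
  have ap0 : 0 < a `^ p by rewrite powR_gt0.
  have : (D l)%:R <= W / (a * t l / 2) `^ p + 1.
    by rewrite /D -[_.+1%:R]natr1 lerD2r truncn_le// divr_ge0// ltW.
  move=> /(ler_wpM2r (powR_ge0 (t l) p)) /le_trans; apply.
  have -> : (a * t l / 2) `^ p = a `^ p * t l `^ p / 2 `^ p.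
    by rewrite !powRM ?mulr_ge0 ?(ltW a0) ?(ltW (t0 _))// -powRN -powR_inv1// -powRrM mulN1r.
  have tp0 : 0 < t l `^ p by rewrite powR_gt0.
  have b0 : 0 < 2 `^ p :> R by rewrite powR_gt0.
  have h : 2 `^ p * W <= 2 `^ p * W / a `^ p.
    by rewrite ler_peMr ?invf_ge1// mulr_ge0 ?ltW.
  have -> : (W / (a `^ p * t l `^ p / 2 `^ p) + 1) * t l `^ p =
    2 `^ p * W / a `^ p + t l `^ p by field; rewrite !gt_eqF.
  apply: le_trans (lerD (lexx _) (le_trans (tL l) h)) _; lra.
pose net l := projT1 (cid (sup_net nik W0 p0 z (at0 l) (WD l))).
have netP l : forall f, X f -> Psi f <= 1 ->
    exists w, forall i, `|f (z i) - net l w (z i)| <= a * t l.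
  exact: projT2 (cid (sup_net nik W0 p0 z (at0 l) (WD l))).
pose J := {l : 'I_L & (D l).-tuple (option ('I_(n + n) * bool))}.
(* Net elements far from the unit ball carry no bound on their layers, so they
   are given the zero vector. *)
pose good (j : J) := exists f, [/\ X f, Psi f <= 1 &
  forall i, `|f (z i) - net (tag j) (tagged j) (z i)| <= a * t (tag j)].
pose la (j : J) i := layer p (t (tag j)) (net (tag j) (tagged j) (z i)).
pose b j i := if `[< good j >] then la j (lshift n i) - la j (rshift n i) else 0.
pose V (j : J) := 2 `^ p * (4 * n%:R) * t (tag j) `^ p.
have V0 j : 0 < V j by rewrite !mulr_gt0 ?powR_gt0 ?ltr0n.
have bV j : \sum_i b j i ^+ 2 <= V j.
  rewrite /b; case: asboolP => [[f [Xf f1 fj]]|_]; last first.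
    by rewrite big1 ?(ltW (V0 _))// => i _; rewrite expr0n.
  apply: (@le_trans _ _ (\sum_i t (tag j) `^ p * (la j (lshift n i) + la j (rshift n i)))).
    apply: ler_sum => i _.
    have := layer_ge0 p2 (net (tag j) (tagged j) (z (lshift n i))) (t0 (tag j)).
    have := layer_ge0 p2 (net (tag j) (tagged j) (z (rshift n i))) (t0 (tag j)).
    have := layer_le_top p2 (net (tag j) (tagged j) (z (lshift n i))) (t0 (tag j)).
    have := layer_le_top p2 (net (tag j) (tagged j) (z (rshift n i))) (t0 (tag j)).
    rewrite -/(la j _) -/(la j _); move: (la j _) (la j _) (_ `^ p) => x y c; nra.
  rewrite -mulr_sumr big_split -(big_split_ord _ xpredT (la j)) /= mulrC.
  rewrite ler_pM2r ?powR_gt0//; apply: (@le_trans _ _ (2 `^ p * \sum_i `|f (z i)| `^ p)).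
    rewrite mulr_sumr; apply: ler_sum => i _; apply: layer_le_double => //.
    by rewrite (le_trans (fj i))// ler_pM2r.
  by rewrite ler_pM2l ?powR_gt0// zK.
have small : \sum_j 2 * expR (- (s ^+ 2 / (8 * V j))) < 1.
  set m := ((n + n) * 2).+1 in Q sQ.
  have L0 : 0 < 2 * L.+1%:R :> R by rewrite mulr_gt0.
  have eQ : expR Q = m%:R * (2 * L.+1%:R) by rewrite expRD !lnK ?posrE.
  have Q0 : 0 <= Q.
    by rewrite addr_ge0// ln_ge0 ?ler1n// -natrM ler1n muln_gt0.
  apply: (@le_lt_trans _ _
     (\sum_(l < L) \sum_(w : (D l).-tuple (option ('I_(n + n) * bool)))
       2 * expR (- Q) ^+ D l)).
    rewrite (@sig_big_dep R 0 _ 'I_L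
      (fun l => (D l).-tuple (option ('I_(n + n) * bool))) xpredT
      (fun _ => xpredT) (fun l _ => 2 * expR (- Q) ^+ D l)) /=.
    apply: ler_sum => -[l w] _; rewrite ler_pM2l// -expRM_natl ler_expR mulrN lerN2.
    rewrite ler_pdivlMr; last by rewrite mulr_gt0.
    rewrite /V /=.
    have h8 : 0 <= 32 * 2 `^ p * n%:R * Q by rewrite !mulr_ge0 ?powR_ge0.
    have := ler_wpM2l h8 (DW l).
    have -> : 32 * 2 `^ p * n%:R * Q * (2 * W * 2 `^ p / a `^ p) =
       64 * 4 `^ p * n%:R * W * Q / a `^ p.
      by rewrite (_ : 4 = 2 * 2 :> R) ?powRM//; [ring|lra].
    move=> /le_trans H; apply: le_trans (H (s ^+ 2) _); last first.
      by rewrite ler_pdivrMr ?powR_gt0.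
    by rewrite le_eqVlt; apply/orP; left; apply/eqP; ring.
  apply: (@le_lt_trans _ _ (\sum_(l < L) L.+1%:R^-1)).
    apply: ler_sum => l _; rewrite sumr_const card_tuple card_option card_prod.
    rewrite card_ord card_bool -/m -[_ *+ (_ ^ _)]mulr_natl natrX mulrCA -exprMn.
    have -> : m%:R * expR (- Q) = (2 * L.+1%:R)^-1.
      by rewrite expRN eQ invfM mulrA divff ?mul1r// pnatr_eq0.
    have -> : L.+1%:R^-1 = 2 * (2 * L.+1%:R)^-1 :> R by rewrite invfM mulrA divff ?mul1r.
    rewrite ler_pM2l// exprS ler_piMr ?invr_ge0 ?(ltW L0)// exprn_ile1 ?invr_ge0 ?(ltW L0)//.
    by rewrite invf_le1// -natrM ler1n muln_gt0.
  by rewrite sumr_const card_ord -[_ *+ _]mulr_natl ltr_pdivrMr// mul1r ltr_nat.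
have [e eP] := exists_balancing_signs V0 bV s0 small.
exists (fun i => if e i then rshift n i else lshift n i) => f Xf f1.
pose F i := `|f (z i)| `^ p.
pose G i := Num.min `|f (z i)| a `^ p.
have FG i : F i = G i + \sum_(l < L) layer p (t l) (f (z i)).
  apply: powR_layers => //.
  have [_ _ _ Psi_nik] := nik; rewrite leNgt; apply/negP => lt.
  have := gt0_ltr_powR p0 _ _ lt; rewrite !nnegrE normr_ge0 mulr_ge0 ?exprn_ge0 ?(ltW a0)//.
  move=> /(_ isT isT); apply/negP; rewrite -leNgt.
  apply: le_trans (Psi_nik _ (z i) Xf) _; apply: le_trans _ WL.
  by rewrite ler_piMr// ltW.
have -> : 2 * (\sum_i F (if e i then rshift n i else lshift n i)) - \sum_i F i =
    \sum_i (-1) ^+ e i * (G (lshift n i) - G (rshift n i)) +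
    \sum_(l < L) \sum_i (-1) ^+ e i *
      (layer p (t l) (f (z (lshift n i))) - layer p (t l) (f (z (rshift n i)))).
  rewrite exchange_big /= -big_split /= big_split_ord /= -big_split /= mulr_sumr -sumrB.
  apply: eq_bigr => i _; rewrite -mulr_sumr sumrB -mulrDr !FG.
  by case: (e i); rewrite ?expr1 ?expr0; ring.
have -> : n%:R * a * (1 + 8 * p * 4 `^ p) + L%:R * s =
  n%:R * a + (L%:R * s + p * a * (2 * (4 `^ p * (4 * n%:R)))) by ring.
apply: le_trans (ler_normD _ _) _; apply: lerD.
  apply: le_trans (ler_norm_sum _ _ _) _.
  rewrite mulr_natl -[n in _ *+ n]card_ord -sumr_const; apply: ler_sum => i _.
  rewrite normrM normr_sign mul1r.
  have Ga k : 0 <= G k <= a.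
    rewrite powR_ge0 /=; have ap : a `^ p <= a by rewrite ge1r_powR// a0/=; lra.
    apply: le_trans _ ap; rewrite ge0_ler_powR ?nnegrE ?(ltW p0) ?(ltW a0)//.
      by rewrite le_min normr_ge0 ltW.
    by rewrite ge_min lexx orbT.
  by have := Ga (lshift n i); have := Ga (rshift n i); rewrite ler_norml; lra.
pose c l i := if t l <= 4 * `|f (z i)| then p * a * t l `^ p else 0.
apply: (@le_trans _ _ (\sum_(l < L) (s + \sum_i c l i))).
  apply: le_trans (ler_norm_sum _ _ _) _; apply: ler_sum => l _.
  have [w fw] := netP l f Xf f1.
  pose j : J := Tagged (fun l : 'I_L => (D l).-tuple (option ('I_(n + n) * bool))) w.
  have jgood : good j by exists f.
  have dc i : `|layer p (t l) (f (z i)) - la j i| <= c l i.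
    by apply: layer_approx => //; exact: fw.
  have := eP j; rewrite /b asboolT// => ej.
  rewrite big_split_ord /= -big_split /=.
  apply: (@le_trans _ _ (`|\sum_i (-1) ^+ e i * (la j (lshift n i) - la j (rshift n i))| +
     `|\sum_i (-1) ^+ e i * ((layer p (t l) (f (z (lshift n i))) - la j (lshift n i)) -
        (layer p (t l) (f (z (rshift n i))) - la j (rshift n i)))|)).
    rewrite (le_trans _ (ler_normD _ _))// -big_split /= le_eqVlt; apply/orP; left.
    by apply/eqP; congr (`|_|); apply: eq_bigr => i _; ring.
  apply: lerD => //; apply: le_trans (ler_norm_sum _ _ _) _; apply: ler_sum => i _.
  by rewrite normrM normr_sign mul1r (le_trans (ler_normB _ _))// lerD.
rewrite big_split /= sumr_const card_ord mulr_natl lerD2l exchange_big /=.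
apply: (@le_trans _ _ (\sum_i p * a * (2 * (4 `^ p * F i)))).
  apply: ler_sum => i _.
  have := sum_dyadic_powR p2 L a0 (mulr_ge0 (ler0n R 4) (normr_ge0 (f (z i)))).
  rewrite powRM// => /(ler_wpM2l (mulr_ge0 (ltW p0) (ltW a0))); apply: le_trans.
  by rewrite mulr_sumr; apply: ler_sum => l _; rewrite /c -/(t l); case: ifP; rewrite ?mulr0.
rewrite -mulr_sumr ler_pM2l ?mulr_gt0// -mulr_sumr ler_pM2l// -mulr_sumr.
by rewrite ler_pM2l ?powR_gt0// zK.
Qed.
End halving.

(** * The error of one halving *)

Lemma one_half_le_ln2 (R : realType) : 2^-1 <= ln 2 :> R.
Proof.
rewrite -ler_expR lnK ?posrE// -[2^-1]opprK expRN.
rewrite -[leRHS]invrK lef_pV2 ?posrE ?expR_gt0 ?invr_gt0//.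
by have := expR_ge1Dx (- 2^-1 : R); lra.
Qed.

Lemma one_plus_ln_le (R : realType) (y : R) : 1 <= y ->
  1 + ln y <= 13 * y `^ 12^-1.
Proof.
move=> y1; have y0 : 0 < y by lra.
have := ln_sublinear (powR_gt0 12^-1 y0); rewrite ln_powR.
have : 1 <= y `^ 12^-1 by rewrite -{1}(powRr0 y) ler_powR// invr_ge0.
by move: (y `^ _) (ln y) => x l; lra.
Qed.

(** The least number of doublings that lead from [a] to the maximum
    [W ^ (1 / p)] of the unit ball. *)
Lemma dyadic_depth (R : realType) (p W a : R) :
  1 <= W -> 2 <= p -> 0 < a -> a <= 4^-1 ->
  exists L : nat, [/\ W <= (a * 2 ^+ L) `^ p, (a * 2 ^+ L) `^ p <= 2 `^ p * W &
    L%:R <= 1 + ln W + 2 * (- ln a)].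
Proof.
move=> W1 p2 a0 a4; have p0 : 0 < p by lra.
have exL : exists L : nat, W <= (a * 2 ^+ L) `^ p.
  pose k := (Num.truncn (W / a)).+1.
  exists k.
  have h : W <= a * 2 ^+ k.
    rewrite -ler_pdivrMl// mulrC ltW// (lt_le_trans (truncnS_gt _))// -natrX ler_nat.
    by rewrite ltnW// ltn_expl.
  have h1 : 1 <= a * 2 ^+ k by lra.
  by rewrite (le_trans h)// le1r_powR//; lra.
have [L WL minL] := ex_minnP exL; exists L.
case: L WL minL => [|L] WL minL.
  exfalso; move: WL; apply/negP; rewrite -ltNge mulr1 (lt_le_trans _ W1)//.
  have /le_lt_trans : a `^ p <= a by rewrite ge1r_powR//; lra.
  by apply; lra.
have lt : (a * 2 ^+ L) `^ p < W.
  by rewrite ltNge; apply/negP => /minL; rewrite ltnn.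
split=> //.
  rewrite exprSr mulrA mulrC powRM ?mulr_ge0 ?exprn_ge0 ?(ltW a0)//.
  by rewrite ler_pM2l ?powR_gt0// ltW.
move: lt; rewrite -ltr_ln ?posrE ?powR_gt0 ?mulr_gt0 ?exprn_gt0//; last by lra.
rewrite ln_powR lnM ?posrE ?exprn_gt0// lnXn// -[_ *+ L]mulr_natl => lt.
have lW : 0 <= ln W by rewrite ln_ge0.
have l2 := one_half_le_ln2 R; have l20 : 0 < ln 2 :> R by lra.
have : ln a + L%:R * ln 2 <= ln W / 2.
  have : ln a + L%:R * ln 2 <= ln W / p by rewrite ler_pdivlMr// [leLHS]mulrC ltW.
  move/le_trans; apply; apply: ler_wpM2l => //.
  by rewrite lef_pV2 ?posrE.
have := ler_wpM2l (ler0n R L) l2; rewrite -[L.+1%:R]natr1; lra.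
Qed.

(** The ratio [y] of the number of points to [W * (1 + ln W) ^ 3] governs the
    error. The choice [a = y ^ (- (4 p)^-1) / 4] costs only a factor [y ^ (1/4)]
    in the deviation, since [a ^ p] is of order [y ^ (- 1/4)], and it makes the
    approximation error a negative power of [y]. Both the number of layers and
    [ln n] are of order [u = (1 + ln W) * (1 + ln y)]. The layers enter squared
    and [ln n] once, which is the origin of the cube. *)
Lemma halving_rate (R : realType) (p : R) : 2 <= p ->
  exists2 A : R, 1 <= A &
  forall (T : Type) (W : R) (X : set (T -> R^o)) (Psi : (T -> R^o) -> R),
    nikolskii_functional p W X Psi -> 1 <= W ->
  forall (n : nat) (z : 'I_(n + n) -> T) (y : R),
    1 <= y -> n%:R = y * (W * (1 + ln W) ^+ 3) ->
    (forall f, X f -> Psi f <= 1 -> \sum_i `|f (z i)| `^ p <= 4 * n%:R) ->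
  exists e : 'I_n -> 'I_(n + n), forall f, X f -> Psi f <= 1 ->
    `|2 * (\sum_i `|f (z (e i))| `^ p) - \sum_i `|f (z i)| `^ p| <=
    A * n%:R * y `^ - (4 * p)^-1.
Proof.
move=> p2; have p0 : 0 < p by lra.
have p4 : 0 < 4 * p by lra.
pose c : R := 13 ^+ 3; have c0 : 0 <= c by rewrite exprn_ge0.
pose b : R := 64 * 16 `^ p; have b0 : 0 <= b by rewrite mulr_ge0 ?powR_ge0.
have [c23 c23E c230] : exists2 x : R, x = 23 & 0 <= x by exists 23.
pose K2 : R := 36 * (b * c23) * c.
have K20 : 0 <= K2 by rewrite !mulr_ge0.
pose K := Num.sqrt K2.
have K0 : 0 <= K by rewrite sqrtr_ge0.
exists (1 + 2 * p * 4 `^ p + K); first by have := mulr_ge0 (ltW p0) (powR_ge0 4 p); lra.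
move=> T W X Psi nik W1 n z y y1 nE zK.
have y0 : 0 < y by lra.
set ell := 1 + ln W in nE.
have ell1 : 1 <= ell by have := ln_ge0 W1; rewrite /ell; lra.
have W0 : 0 < W by lra.
have n1 : 1 <= n%:R :> R.
  rewrite nE -[1]mulr1 ler_pM// ?ler01// -[1]mulr1 ler_pM// ?ler01//.
  by rewrite exprn_ege1.
have n0 : (0 < n)%N by rewrite -(ler1n R).
pose th := (4 * p)^-1; have th0 : 0 < th by rewrite invr_gt0.
pose a := y `^ (- th) / 4.
have yth0 : 0 < y `^ (- th) by rewrite powR_gt0.
have a0 : 0 < a by rewrite divr_gt0.
have a4 : a <= 4^-1.
  rewrite /a ler_pdivrMr// mulVf// -[leRHS](powRr0 y) ler_powR// lerNl oppr0 ltW//.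
have [L [WL LW Lup]] := dyadic_depth W1 p2 a0 a4.
have ap : a `^ p = y `^ (- 4^-1) / 4 `^ p.
  have q4 : 4^-1 `^ p = (4 `^ p)^-1 :> R.
    by rewrite -[4^-1]powR_inv1// -powRrM mulN1r powRN.
  rewrite /a powRM ?invr_ge0 ?powR_ge0// q4 -powRrM.
  by congr (_ `^ _ / _); rewrite /th; field; lra.
pose g := 1 + ln y; have lny : 0 <= ln y by rewrite ln_ge0.
pose u := ell * g.
have uy : ell + ln y <= u by rewrite /u /g; nra.
have Lu : L%:R <= 6 * u.
  have : - ln a <= ln y + 2.
    rewrite /a lnM ?posrE ?invr_gt0// ln_powR lnV ?posrE//.
    rewrite (_ : 4 = 2 ^+ 2 :> R) ?lnXn//; last by rewrite expr2; lra.
    have : ln 2 <= 1 :> R.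
      by have := le_ln1Dx (_ : -1 < 1 :> R); rewrite (_ : 1 + 1 = 2 :> R)//; apply; lra.
    have : th <= 1 by rewrite invf_le1//; lra.
    rewrite -mulr_natl; nra.
  by rewrite /ell in uy ell1 *; lra.
pose Q : R := ln ((n + n) * 2).+1%:R + ln (2 * L.+1%:R).
have Qu : Q <= c23 * u.
  rewrite c23E.
  have h1 : ln (2 * L.+1%:R) <= 14 * u.
    rewrite (le_trans (ltW (ln_sublinear _))) ?mulr_gt0// -[L.+1%:R]natr1; lra.
  have h2 : ln ((n + n) * 2).+1%:R <= 9 * u.
    apply: (@le_trans _ _ (ln (5 * n%:R))).
      rewrite ler_ln ?posrE// ?mulr_gt0 ?ltr0n// -natrM ler_nat.
      by rewrite addnn -!muln2 -mulnA; move: n0; clear; lia.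
    have e0 : 0 < ell by lra.
    have l3 : ln (ell ^+ 3) = 3 * ln ell by rewrite lnXn// -[_ *+ 3]mulr_natl.
    rewrite nE; move: (ell ^+ 3) (exprn_gt0 3 e0) l3 => e3 e30 l3.
    rewrite !lnM ?posrE ?mulr_gt0// l3.
    have := @ln_sublinear R 5 ltac:(by []); have := ln_sublinear e0.
    have : ln W <= ell by rewrite /ell; lra.
    lra.
  by rewrite /Q; lra.
have u0 : 0 <= u by lra.
pose s2 := b * n%:R * W * (c23 * u) * y `^ 4^-1.
have cu0 : 0 <= c23 * u by rewrite mulr_ge0.
have bnW0 : 0 <= b * n%:R * W := mulr_ge0 (mulr_ge0 b0 (ler0n R n)) (ltW W0).
have s20 : 0 <= s2 := mulr_ge0 (mulr_ge0 bnW0 cu0) (powR_ge0 y 4^-1).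
pose s := Num.sqrt s2.
have sQ : 64 * 4 `^ p * n%:R * W * Q <= s ^+ 2 * a `^ p.
  rewrite sqr_sqrtr// ap powRN /s2 /b (_ : 16 = 4 * 4 :> R); last lra.
  rewrite powRM//.
  have y40 : 0 < y `^ 4^-1 by rewrite powR_gt0.
  have f40 : 0 < 4 `^ p :> R by rewrite powR_gt0.
  have -> : 64 * (4 `^ p * 4 `^ p) * n%:R * W * (c23 * u) * y `^ 4^-1 *
     ((y `^ 4^-1)^-1 / 4 `^ p) = 64 * 4 `^ p * n%:R * W * (c23 * u).
    by field; rewrite !gt_eqF.
  by rewrite ler_wpM2l// mulr_ge0 ?(ltW W0)// mulr_ge0// mulr_ge0 ?powR_ge0.
have [e eP] := halving_step nik W1 p2 n0 a0 a4 WL LW (sqrtr_ge0 s2) sQ zK.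
exists e => f Xf f1; apply: le_trans (eP f Xf f1) _.
have Ls : L%:R * s <= K * n%:R * y `^ (- th).
  apply: (@le_trans _ _ (6 * u * s)); first by rewrite ler_wpM2r ?sqrtr_ge0.
  apply: (@le_trans _ _ (K * n%:R * y `^ (- 4^-1))); last first.
    rewrite ler_wpM2l ?mulr_ge0// ler_powR// lerN2 lef_pV2 ?posrE//; lra.
  have h1 : 6 * u * s \is Num.nneg.
    by rewrite nnegrE; apply: mulr_ge0 (sqrtr_ge0 _); apply: mulr_ge0.
  have h2 : K * n%:R * y `^ (- 4^-1) \is Num.nneg.
    by rewrite nnegrE; apply: mulr_ge0 (powR_ge0 _ _); apply: mulr_ge0.
  rewrite -(@ler_pXn2r _ 2 isT _ _ h1 h2).
  have -> : (6 * u * s) ^+ 2 = 36 * u ^+ 2 * s ^+ 2 by ring.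
  have -> : (K * n%:R * y `^ (- 4^-1)) ^+ 2 =
    K ^+ 2 * n%:R ^+ 2 * (y `^ (- 4^-1)) ^+ 2 by ring.
  rewrite !sqr_sqrtr// /s2 /K2.
  pose Y := y `^ 12^-1; have Y0 : 0 < Y by rewrite powR_gt0.
  have Yn k : y `^ (k%:R / 12) = Y ^+ k by rewrite mulrC powRrM powR_mulrn ?powR_ge0.
  have -> : y `^ 4^-1 = Y ^+ 3 by rewrite -Yn; congr (_ `^ _); lra.
  rewrite powRN; have -> : y `^ 4^-1 = Y ^+ 3 by rewrite -Yn; congr (_ `^ _); lra.
  have yE : y = Y ^+ 12 by rewrite -Yn divff// powRr1// ltW.
  have gY : g ^+ 3 <= c * Y ^+ 3.
    have gl : g <= 13 * Y := one_plus_ln_le y1.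
    have g0 : 0 <= g by rewrite /g; lra.
    by rewrite -exprMn lerXn2r// nnegrE//; lra.
  have nW : W * ell ^+ 3 = n%:R / Y ^+ 12 by rewrite nE yE; field; rewrite gt_eqF.
  have -> : 36 * u ^+ 2 * (b * n%:R * W * (c23 * u) * Y ^+ 3) =
     36 * (b * c23) * n%:R * (W * ell ^+ 3) * Y ^+ 3 * g ^+ 3.
    by rewrite /u; ring.
  rewrite nW.
  have -> : 36 * (b * c23) * c * n%:R ^+ 2 * (Y ^+ 3)^-1 ^+ 2 =
    36 * (b * c23) * n%:R * (n%:R / Y ^+ 12) * Y ^+ 3 * (c * Y ^+ 3).
    by field; rewrite gt_eqF.
  apply: ler_wpM2l => //; apply: mulr_ge0; last by rewrite exprn_ge0// ltW.
  apply: mulr_ge0; last by rewrite divr_ge0// exprn_ge0// ltW.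
  by apply: mulr_ge0 => //; apply: mulr_ge0 => //; apply: mulr_ge0.
apply: le_trans (lerD (lexx _) Ls) _.
have := mulr_ge0 (ler0n R n) (ltW yth0); rewrite /a -/th.
by move: (y `^ - th) (4 `^ p) => Y P; lra.
Qed.

(** * Repeated halving *)

Lemma sum_geometric_le (R : realType) (r : R) (k : nat) : 0 <= r -> r < 1 ->
  \sum_(i < k) r ^+ i <= (1 - r)^-1.
Proof.
move=> r0 r1; rewrite -[leRHS]mul1r ler_pdivlMr ?subr_gt0// mulrC.
by have := subrX1 r k; have := exprn_ge0 k r0; nra.
Qed.

(** The ratio [y] of [halving_rate] is at least [C * 2 ^ k] when [k] more halvings
    are to follow, so the errors form a geometric series whose largest term comes
    from the last halving. [C] is chosen such that the series sums to at most
    [eps]. The condition [del + eps <= 1] keeps all averages over the unit ball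
    bounded by 2, as [halving_rate] requires. *)
Lemma subsampling (R : realType) (p eps : R) : 2 <= p -> 0 < eps -> eps <= 1 ->
  exists2 C : R, 1 <= C &
  forall (T : Type) (W : R) (X : set (T -> R^o)) (Psi : (T -> R^o) -> R),
    nikolskii_functional p W X Psi -> 1 <= W ->
  forall (m k : nat) (z : 'I_(iter k (fun n => n + n)%N m) -> T) (del : R),
    C * (W * (1 + ln W) ^+ 3) <= m%:R -> del + eps <= 1 ->
    (forall f, X f -> Psi f <= 1 ->
      `|(iter k (fun n => n + n)%N m)%:R^-1 * (\sum_i `|f (z i)| `^ p) - Psi f| <= del) ->
  exists xi : 'I_m -> T, forall f, X f -> Psi f <= 1 ->
    `|m%:R^-1 * (\sum_i `|f (xi i)| `^ p) - Psi f| <= del + eps.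
Proof.
move=> p2 eps0 eps1; have p0 : 0 < p by lra.
have [A A1 AP] := halving_rate p2.
have A0 : 0 < A by lra.
pose th := (4 * p)^-1; have th0 : 0 < th by rewrite invr_gt0; lra.
pose r : R := 2 `^ (- th); have r0 : 0 < r by rewrite powR_gt0.
have r1 : r < 1.
  rewrite /r powRN invf_lt1 ?powR_gt0//.
  have := gt0_ltr_powR th0 (_ : 1 \in Num.nneg) (_ : 2 \in Num.nneg).
  by rewrite powR1; apply; rewrite ?nnegrE ?ltr1n.
pose v := eps * (1 - r) / A.
have v0 : 0 < v by rewrite divr_gt0// mulr_gt0//; lra.
have v1 : v <= 1 by rewrite /v ler_pdivrMr// mul1r; nra.
pose C := v `^ (- (4 * p)).
have C1 : 1 <= C.
  by rewrite /C -[leLHS](powRr0 v); apply: ger_powR; [rewrite v0|lra].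
have Cv : C `^ (- th) = v.
  rewrite /C -powRrM (_ : _ * _ = 1) ?powRr1 ?(ltW v0)// /th; field; lra.
exists C => // T W X Psi nik W1 m k z del Cm.
have W0 : 0 < W by lra.
have ell1 : 1 <= 1 + ln W by have := ln_ge0 W1; lra.
pose w := W * (1 + ln W) ^+ 3.
have w1 : 1 <= w by rewrite -[1]mulr1 ler_pM// ?ler01// exprn_ege1.
have w0 : 0 < w by lra.
have m0 : 0 < m%:R :> R by apply: lt_le_trans Cm; rewrite mulr_gt0//; lra.
have Avr k' : 0 <= A * v * r ^+ k'.
  by apply: mulr_ge0; [apply: mulr_ge0; exact: ltW|exact: exprn_ge0 (ltW r0)].
pose B k := A * v * \sum_(i < k) r ^+ i.
have Beps j : B j <= eps.
  have := sum_geometric_le j (ltW r0) r1.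
  move=> /(ler_wpM2l (ltW (mulr_gt0 A0 v0))) /le_trans; apply.
  by rewrite /v le_eqVlt; apply/orP; left; apply/eqP; field; lra.
suff H : del + B k <= 1 ->
   (forall f, X f -> Psi f <= 1 ->
      `|(iter k (fun n => n + n)%N m)%:R^-1 * (\sum_i `|f (z i)| `^ p) - Psi f| <= del) ->
   exists xi : 'I_m -> T, forall f, X f -> Psi f <= 1 ->
    `|m%:R^-1 * (\sum_i `|f (xi i)| `^ p) - Psi f| <= del + B k.
  move=> de /H[|xi xiP]; first by have := Beps k; lra.
  by exists xi => f Xf f1; apply: le_trans (xiP f Xf f1) _; rewrite lerD2l.
elim: k z del => [|k IH] z del; first by move=> _ h; exists z; rewrite /B big_ord0 mulr0 addr0.
move: z; rewrite /=; set n := iter k _ m => z.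
have nE : n%:R = 2 ^+ k * m%:R :> R.
  rewrite /n; elim: (k) => [|j IHj] /=; first by rewrite mul1r.
  by rewrite natrD IHj exprS; ring.
have n0 : 0 < n%:R :> R by rewrite nE mulr_gt0 ?exprn_gt0.
have -> : B k.+1 = A * v * r ^+ k + B k by rewrite /B big_ord_recr /=; ring.
move=> dB zP.
pose y := n%:R / w.
have yC : C * 2 ^+ k <= y.
  by rewrite /y nE ler_pdivlMr// mulrAC mulrC ler_pM2l ?exprn_gt0.
have y1 : 1 <= y by apply: le_trans yC; rewrite -[1]mulr1 ler_pM// ?ler01// exprn_ege1//; lra.
have yv : y `^ (- th) <= v * r ^+ k.
  have -> : v * r ^+ k = (C * 2 ^+ k) `^ (- th).
    rewrite powRM ?exprn_ge0//; last by lra.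
    by rewrite Cv -[2 ^+ k]powR_mulrn// -powRrM [k%:R * _]mulrC powRrM -/r powR_mulrn ?powR_ge0.
  have C2 : 0 < C * 2 ^+ k by rewrite mulr_gt0 ?exprn_gt0//; lra.
  have y0 : 0 < y by lra.
  rewrite !powRN lef_pV2 ?posrE ?powR_gt0//.
  by rewrite ge0_ler_powR ?nnegrE ?(ltW th0) ?(ltW C2) ?(ltW y0).
have ze f : X f -> Psi f <= 1 -> \sum_i `|f (z i)| `^ p <= 4 * n%:R.
  move=> Xf f1; have := zP f Xf f1.
  rewrite natrD ler_norml => /andP[_].
  have B0 : 0 <= B k.
    apply: mulr_ge0; first by apply: mulr_ge0; exact: ltW.
    by apply: sumr_ge0 => i _; exact: exprn_ge0 (ltW r0).
  have := Avr k; rewrite lerBlDr ler_pdivrMl; [|lra]; move: (\sum_i _) => S; nra.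
have [|e eP] := AP T W X Psi nik W1 n z y y1 _ ze.
  by rewrite -/w /y divfK// gt_eqF.
have [||xi xiP] := IH (z \o e) (del + A * v * r ^+ k).
- lra.
- move=> f Xf f1; have h1 := zP f Xf f1; have h2 := eP f Xf f1.
  rewrite -/th in h2; rewrite natrD in h1.
  move: h1 h2; rewrite /=; set S1 := \sum_(i < n + n) _; set S2 := \sum_(i < n) _ => h1 h2.
  have h3 : `|n%:R^-1 * S2 - (n%:R + n%:R)^-1 * S1| <= A * v * r ^+ k.
    have -> : n%:R^-1 * S2 - (n%:R + n%:R)^-1 * S1 = (2 * S2 - S1) / (2 * n%:R).
      by field; lra.
    rewrite normrM [`|(_ * _)^-1|]gtr0_norm ?invr_gt0 ?mulr_gt0// ler_pdivrMr ?mulr_gt0//.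
    apply: le_trans h2 _; have := ler_wpM2l (mulr_ge0 (ltW A0) (ltW n0)) yv.
    have := Avr k.
    by move: (r ^+ k) (y `^ _) => a b h; nra.
  rewrite -/n (_ : n%:R^-1 * S2 - Psi f =
    ((n%:R + n%:R)^-1 * S1 - Psi f) + (n%:R^-1 * S2 - (n%:R + n%:R)^-1 * S1)); last by ring.
  exact: le_trans (ler_normD _ _) (lerD h1 h3).
by exists xi => f Xf f1; apply: le_trans (xiP f Xf f1) _; rewrite addrA.
Qed.

(** * Interpolation in a finite-dimensional space *)

(** Each new function either is already reproduced by the interpolation
    operator [P], or its residual [r] is nonzero at some point, which becomes the
    next node. With this formula a bound on [f] at the nodes controls how much
    [f] oscillates, without an appeal to equivalence of norms. *)
Lemma interpolation_basis (R : realType) (T : Type) (X : set (T -> R^o)) (N : nat)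
    (phi : 'I_N -> T -> R^o) :
  linear_subspace X -> (forall i, X (phi i)) ->
  exists (k : nat) (y : 'I_k -> T) (psi : 'I_k -> T -> R^o),
    (forall j, X (psi j)) /\
    forall c : 'I_N -> R, let f := \sum_(i < N) c i *: phi i in
      f = \sum_(j < k) f (y j) *: psi j.
Proof.
move=> [X0 Xlin]; elim: N phi => [|N IH] phi Xphi.
  exists 0%N, (fun j : 'I_0 => match notF (ltn_ord j) with end), (fun _ => 0).
  by split=> [[]//|c /=]; rewrite !big_ord0.
have [k [y [psi [Xpsi IHf]]]] := IH (fun i => phi (lift ord0 i)) (fun i => Xphi _).
have Xsum (c : 'I_k -> R) : X (\sum_j c j *: psi j).
  elim/big_ind : _ => [//|u v Xu Xv|j _]; first by rewrite -[u]scale1r; exact: Xlin.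
  by rewrite -[_ *: _]addr0; apply: Xlin.
pose P (f : T -> R^o) : T -> R^o := \sum_(j < k) f (y j) *: psi j.
have Plin a u v : P (a *: u + v) = a *: P u + P v.
  rewrite /P scaler_sumr -big_split; apply: eq_bigr => j _ /=.
  by rewrite scalerA -scalerDl.
pose r := phi ord0 - P (phi ord0).
have [r0|rn0] := pselect (r = 0).
  exists k, y, psi; split=> // c; rewrite big_ord_recl /= -/(P _) Plin.
  rewrite {1}(IHf (fun i => c (lift ord0 i))) -/(P _).
  by congr (_ *: _ + _); apply/eqP; rewrite -subr_eq0; apply/eqP.
have [y0 ry0] : exists y0, r y0 != 0.
  apply: contrapT => none; apply: rn0; apply/funext => x; apply/eqP.
  by apply: contrapT => /negP h; apply: none; exists x.
pose q : T -> R^o := (r y0)^-1 *: r.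
have Xr : X r by rewrite /r addrC -scaleN1r; apply: Xlin; [exact: Xsum|exact: Xphi].
have Xq : X q by rewrite -[q]addr0; apply: Xlin.
exists k.+1, (fun j => oapp y y0 (unlift ord0 j)),
  (fun j => oapp (fun j => psi j - psi j y0 *: q) q (unlift ord0 j)).
split=> [j|c f].
  case: unliftP => [j' _|_] //=.
  by rewrite addrC -scaleNr; exact: Xlin.
rewrite big_ord_recl unlift_none /=.
under eq_bigr do rewrite liftK /=.
have -> : \sum_(i < k) f (y i) *: (psi i - psi i y0 *: q) = P f - P f y0 *: q.
  have -> : P f y0 = \sum_(j < k) f (y j) *: psi j y0 by rewrite /P fct_sumE.
  rewrite /P scaler_suml -sumrB; apply: eq_bigr => j _.
  by rewrite scalerBr scalerA.
have [b [f' [fE Pf']]] : exists b f', f = b *: phi ord0 + f' /\ P f' = f'.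
  exists (c ord0), (\sum_(i < N) c (lift ord0 i) *: phi (lift ord0 i)).
  by rewrite /f big_ord_recl; split=> //; rewrite -IHf.
have fP : f - P f = b *: r.
  by rewrite fE Plin Pf' /r scalerBr opprD addrACA subrr addr0.
have -> : f y0 *: q + (P f - P f y0 *: q) = P f + (f y0 - P f y0) *: q.
  by rewrite addrCA scalerBl.
have -> : f y0 - P f y0 = b * r y0 by have := congr1 (fun h => h y0) fP.
by rewrite /q scalerA mulfK// -fP addrC subrK.
Qed.

(** * Rounding a measure to equal masses *)

(** Each weight is rounded down to a multiple of [1 / n], and the points left
    over are placed at an arbitrary node; both effects cost [#|I| * G / n]. *)
Lemma weights_rounding (R : realType) (I : finType) (T : Type) (x : I -> T)
    (w : I -> R) (n : nat) :
  (0 < n)%N -> (forall i, 0 <= w i) -> \sum_i w i = 1 ->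
  exists z : 'I_n -> T, forall (g : T -> R) (G : R),
    (forall i, 0 <= g (x i) <= G) ->
    `|n%:R^-1 * (\sum_j g (z j)) - \sum_i w i * g (x i)| <= 2 * #|I|%:R * G / n%:R.
Proof.
move=> n0 w0 w1.
have [i0 _] : exists i0 : I, True.
  apply: contrapT => none; move: w1; rewrite big1 => [/eqP|i _].
    by rewrite eq_sym oner_eq0.
  by exfalso; apply: none; exists i.
have nR0 : 0 < n%:R :> R by rewrite ltr0n.
pose c i := Num.truncn (n%:R * w i).
have cw i : (c i)%:R <= n%:R * w i <= (c i)%:R + 1.
  have := truncn_itv (mulr_ge0 (ltW nR0) (w0 i)); rewrite -/(c i) natr1.
  by move=> /andP[-> /ltW].
have cn : (\sum_i c i <= n)%N.
  rewrite -(ler_nat R) natr_sum (_ : n%:R = \sum_i n%:R * w i); last by rewrite -mulr_sumr w1 mulr1.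
  by apply: ler_sum => i _; have /andP[] := cw i.
pose r := (n - \sum_i c i)%N.
pose sq := flatten [seq nseq (c i) i | i <- index_enum I] ++ nseq r i0.
have szsq : size sq = n.
  rewrite size_cat size_flatten size_nseq /shape -map_comp sumnE big_map.
  by under eq_bigr do rewrite /= size_nseq; rewrite /r subnKC.
have sumsq (g : T -> R) : \sum_(i <- sq) g (x i) =
    \sum_i (c i)%:R * g (x i) + r%:R * g (x i0).
  rewrite big_cat big_flatten big_map big_nseq iter_addr_0 mulr_natl; congr (_ + _).
  by apply: eq_bigr => i _; rewrite big_nseq iter_addr_0 mulr_natl.
exists (fun j => x (nth i0 sq j)) => g G gG.
have -> : \sum_(j < n) g (x (nth i0 sq j)) = \sum_(i <- sq) g (x i).
  by rewrite (big_nth i0) szsq big_mkord.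
have rE : r%:R = \sum_i (n%:R * w i - (c i)%:R) :> R.
  by rewrite /r natrB// sumrB -mulr_sumr w1 mulr1 natr_sum.
have rI : r%:R <= #|I|%:R :> R.
  rewrite rE -sumr_const; apply: ler_sum => i _; have := cw i; lra.
have -> : n%:R^-1 * (\sum_(i <- sq) g (x i)) - \sum_i w i * g (x i) =
    (r%:R * g (x i0) - \sum_i (n%:R * w i - (c i)%:R) * g (x i)) / n%:R.
  rewrite sumsq; under [in RHS]eq_bigr do rewrite mulrBl -mulrA.
  rewrite sumrB -mulr_sumr; field; lra.
rewrite normrM [`|n%:R^-1|]gtr0_norm ?invr_gt0// ler_pM2r ?invr_gt0//.
have h1 : 0 <= r%:R * g (x i0) <= #|I|%:R * G.
  by have := gG i0; move: rI (ler0n R r) => rI r0; nra.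
have h2 : 0 <= \sum_i (n%:R * w i - (c i)%:R) * g (x i) <= #|I|%:R * G.
  rewrite sumr_ge0/=; last by move=> i _; have := cw i; have := gG i; nra.
  rewrite mulr_natl -sumr_const; apply: ler_sum => i _.
  by have := cw i; have := gG i; nra.
rewrite ler_norml; lra.
Qed.

(** The pieces are the fibres of the vector of the values rounded to multiples
    of [tau]. *)
Lemma oscillation_partition (R : realType) (d : measure_display)
    (T : measurableType d) (k : nat) (psi : 'I_k -> T -> R) (b tau : R) :
  0 < tau -> (forall j, measurable_fun setT (psi j)) ->
  (forall j x, `|psi j x| <= b) ->
  exists (I : finType) (key : T -> I),
    (forall i, measurable (key @^-1` [set i])) /\
    (forall x y, key x = key y -> forall j, `|psi j x - psi j y| <= tau).
Proof.
move=> tau0; elim: k psi => [|k IH] psi mpsi bpsi.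
  exists unit, (fun _ => tt); split=> [[]|x y _ []//].
  by rewrite (_ : _ @^-1` _ = setT)//; apply/seteqP; split.
have [I [key [mkey okey]]] := IH (fun j => psi (lift ord0 j)) (fun j => mpsi _) (fun j => bpsi _).
pose psi0 := psi ord0.
pose Q := (Num.truncn (2 * b / tau)).+1.
pose h x := Num.truncn ((psi0 x + b) / tau).
have psib x : 0 <= psi0 x + b <= 2 * b.
  by have := bpsi ord0 x; rewrite ler_norml -/psi0; lra.
have h0 x : 0 <= (psi0 x + b) / tau by rewrite divr_ge0 ?(ltW tau0)//; have := psib x; lra.
have hQ x : (h x < Q)%N.
  rewrite ltnS truncn_le_nat; apply: le_lt_trans (truncnS_gt _).
  by rewrite ler_pM2r ?invr_gt0//; have := psib x; lra.
have hitv x : (h x)%:R <= (psi0 x + b) / tau < (h x).+1%:R := truncn_itv (h0 x).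
exists (I * 'I_Q)%type, (fun x => (key x, Ordinal (hQ x))); split=> [[i l]|x y [kxy hxy] j].
  rewrite (_ : _ @^-1` _ = key @^-1` [set i] `&`
     (psi0 @^-1` `[l%:R * tau - b, l.+1%:R * tau - b[%classic)); last first.
    have hE x : (l%:R * tau - b <= psi0 x < l.+1%:R * tau - b) = (h x == l :> nat).
      rewrite lerBlDr ltrBrDr -ler_pdivlMr// -ltr_pdivrMr//.
      by rewrite /h truncn_eq.
    apply/seteqP; split=> x /=.
      by move=> [<- lE]; split=> //=; rewrite in_itv/= hE -lE.
    by move=> [<-]; rewrite in_itv/= hE => /eqP hx; congr pair; apply: val_inj.
  apply: measurableI => //; rewrite -[X in measurable X]setTI; apply: mpsi => //.
have [j' ->|->] := unliftP ord0 j; first exact: okey.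
have := hitv x; have := hitv y; rewrite -/psi0 hxy => hy hx.
have : `|(psi0 x + b) / tau - (psi0 y + b) / tau| <= 1.
  by move: hx hy; rewrite -natr1 ler_norml; lra.
rewrite -mulrBl normrM [`|tau^-1|]gtr0_norm ?invr_gt0// ler_pdivrMr// mul1r.
by rewrite opprD addrACA subrr addr0.
Qed.

(** * Quadrature with arbitrarily many points *)

Section probability_mean.
Variables (R : realType) (d : measure_display) (T : measurableType d).
Variable mu : probability T R.

Definition bounded_measurable (f : T -> R) :=
  measurable_fun setT f /\ exists b, forall x, `|f x| <= b.

Lemma bounded_measurable_integrable f :
  bounded_measurable f -> mu.-integrable setT (EFin \o f).
Proof.
move=> [mf [b fb]]; apply: measurable_bounded_integrable => //.
  by rewrite (le_lt_trans (probability_le1 mu _))// ltry.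
by exists b; split; rewrite ?num_real// => M bM x _ /=; rewrite (le_trans (fb x))// ltW.
Qed.

Lemma bounded_measurable_cst c : bounded_measurable (fun _ => c).
Proof. by split; [exact: measurable_cst|exists `|c|]. Qed.

Lemma bounded_measurableD f g : bounded_measurable f -> bounded_measurable g ->
  bounded_measurable (fun x => f x + g x).
Proof.
move=> [mf [a fa]] [mg [b gb]]; split; first exact: measurable_funD.
by exists (a + b) => x; rewrite (le_trans (ler_normD _ _))// lerD.
Qed.

Lemma bounded_measurableZ c f : bounded_measurable f ->
  bounded_measurable (fun x => c * f x).
Proof.
move=> [mf [a fa]]; split; first exact: measurable_funM.
by exists (`|c| * a) => x; rewrite normrM ler_wpM2l.
Qed.

Lemma bounded_measurable_indic A : measurable A ->
  bounded_measurable (\1_A : T -> R).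
Proof.
move=> mA; split; first exact: measurable_indic.
by exists 1 => x; rewrite indicE; case: (_ \in _); rewrite ?normr1 ?normr0.
Qed.

Lemma bounded_measurable_powR p f : 0 <= p -> bounded_measurable f ->
  bounded_measurable (fun x => `|f x| `^ p).
Proof.
move=> p0 [mf [b fb]]; split.
  apply: (@measurableT_comp _ _ _ _ _ _ (@powR R ^~ p)) => //; exact: measurableT_comp.
exists (b `^ p) => x; rewrite ger0_norm ?powR_ge0// ge0_ler_powR ?nnegrE//.
by rewrite (le_trans _ (fb x)).
Qed.

Lemma mean_cst c : Rintegral mu setT (fun _ => c) = c.
Proof. by rewrite Rintegral_cst// [X in fine X](@probability_setT _ _ _ mu) mulr1. Qed.

Lemma meanD f g : bounded_measurable f -> bounded_measurable g ->
  Rintegral mu setT (fun x => f x + g x) = Rintegral mu setT f + Rintegral mu setT g.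
Proof. by move=> bf bg; rewrite RintegralD//; exact: bounded_measurable_integrable. Qed.

Lemma meanZ c f : bounded_measurable f ->
  Rintegral mu setT (fun x => c * f x) = c * Rintegral mu setT f.
Proof. by move=> bf; rewrite RintegralZl//; exact: bounded_measurable_integrable. Qed.

Lemma le_mean f g : bounded_measurable f -> bounded_measurable g ->
  (forall x, f x <= g x) -> Rintegral mu setT f <= Rintegral mu setT g.
Proof.
by move=> bf bg fg; apply: le_Rintegral => //; exact: bounded_measurable_integrable.
Qed.

Lemma bounded_measurable_step (I : Type) (s : seq I) (c : I -> R) (A : I -> set T) :
  (forall i, measurable (A i)) ->
  bounded_measurable (fun x => \sum_(i <- s) c i * \1_(A i) x).
Proof.
move=> mA; elim: s => [|i s IH].
  under eq_fun do rewrite big_nil; exact: bounded_measurable_cst.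
under eq_fun do rewrite big_cons; apply: bounded_measurableD => //.
exact/bounded_measurableZ/bounded_measurable_indic.
Qed.

Lemma mean_step (I : Type) (s : seq I) (c : I -> R) (A : I -> set T) :
  (forall i, measurable (A i)) ->
  Rintegral mu setT (fun x => \sum_(i <- s) c i * \1_(A i) x) =
  \sum_(i <- s) c i * fine (mu (A i)).
Proof.
move=> mA; elim: s => [|i s IH].
  by under eq_fun do rewrite big_nil; rewrite mean_cst big_nil.
under eq_fun do rewrite big_cons; rewrite meanD; first last.
- exact: bounded_measurable_step.
- exact/bounded_measurableZ/bounded_measurable_indic.
rewrite IH meanZ; last exact: bounded_measurable_indic.
by rewrite big_cons /Rintegral integral_indic// setIT.
Qed.

Lemma mean_partition (I : finType) (key : T -> I) (x : I -> T) (g : T -> R) (eta : R) :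
  (forall i, measurable (key @^-1` [set i])) ->
  bounded_measurable g -> (forall y, `|g y - g (x (key y))| <= eta) ->
  `|Rintegral mu setT g - \sum_i fine (mu (key @^-1` [set i])) * g (x i)| <= eta.
Proof.
move=> mkey bg og.
have GE y : g (x (key y)) = \sum_i g (x i) * \1_(key @^-1` [set i]) y.
  rewrite (bigD1 (key y))//= big1 ?addr0 => [|i ik].
    by rewrite indicE mem_set// mulr1.
  by rewrite indicE memNset ?mulr0//= => ki; rewrite ki eqxx in ik.
pose G y := \sum_i g (x i) * \1_(key @^-1` [set i]) y.
have bG : bounded_measurable G by exact: bounded_measurable_step.
have mG : Rintegral mu setT G = \sum_i fine (mu (key @^-1` [set i])) * g (x i).
  by rewrite mean_step//; apply: eq_bigr => i _; rewrite mulrC.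
have bc := bounded_measurable_cst eta.
have h1 := le_mean bg (bounded_measurableD bG bc).
have h2 := le_mean bG (bounded_measurableD bg bc).
move: h1 h2; rewrite !meanD// mean_cst mG => h1 h2.
rewrite ler_norml; apply/andP; split.
  have : forall y, G y <= g y + eta by move=> y; have := og y; rewrite GE ler_norml /G; lra.
  by move/h2; lra.
have : forall y, g y <= G y + eta by move=> y; have := og y; rewrite GE ler_norml /G; lra.
by move/h1; lra.
Qed.

Lemma sum_partition_mass (I : finType) (key : T -> I) :
  (forall i, measurable (key @^-1` [set i])) ->
  \sum_i fine (mu (key @^-1` [set i])) = 1.
Proof.
move=> mkey; rewrite -[RHS](mean_cst 1).
have -> : (fun _ : T => 1 : R) = (fun y => \sum_i 1 * \1_(key @^-1` [set i]) y).
  apply/funext => y; rewrite (bigD1 (key y))//= big1 ?addr0 => [|i ik].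
    by rewrite indicE mem_set// mulr1.
  by rewrite indicE memNset ?mulr0//= => ki; rewrite ki eqxx in ik.
by rewrite mean_step//; apply: eq_bigr => i _; rewrite mul1r.
Qed.

(** The number of points has the form [2 ^ k * m] required for halving, and no
    bound on [k] is claimed. On each piece of a fine partition all functions of
    the unit ball are almost constant, so the mean is almost a weighted sum
    over representatives of the pieces, whose weights are then rounded. *)
Lemma uniform_quadrature (p W eta : R) (X : set (T -> R^o)) (N : nat)
    (phi : 'I_N -> T -> R^o) (m : nat)
    (Psi := fun f : T -> R^o => Rintegral mu setT (fun x => `|f x| `^ p)) :
  1 <= p -> 1 <= W -> 0 < eta -> (0 < m)%N ->
  linear_subspace X -> (forall i, X (phi i)) -> spans phi X ->
  (forall f, X f -> bounded_measurable f) ->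
  (forall f x, X f -> `|f x| `^ p <= W * Psi f) ->
  exists (k : nat) (z : 'I_(iter k (fun n => n + n)%N m) -> T),
    forall f, X f -> Psi f <= 1 ->
      `|(iter k (fun n => n + n)%N m)%:R^-1 * (\sum_i `|f (z i)| `^ p) - Psi f| <= eta.
Proof.
move=> p1 W1 eta0 m0 Xsub Xphi phiX Xbm Psi_nik.
have p0 : 0 < p by lra.
have [K [y [psi [Xpsi Xy]]]] := interpolation_basis Xsub Xphi.
have bpsi j : exists b, forall x, `|psi j x| <= b by have [_] := Xbm _ (Xpsi j).
have [b bP] := choice bpsi.
have b0 j : 0 <= b j by rewrite (le_trans _ (bP j point)).
pose e1 := eta / 2.
pose tau := e1 / (p * W * K.+1%:R).
have pWK0 : 0 < p * W * K.+1%:R by rewrite !mulr_gt0//; lra.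
have e10 : 0 < e1 by rewrite divr_gt0.
have tau0 : 0 < tau by rewrite divr_gt0.
have bsum j x : `|psi j x| <= \sum_j b j.
  by rewrite (le_trans (bP j x))// (bigD1 j)//= lerDl sumr_ge0.
have [I [key [mkey okey]]] := oscillation_partition tau0 (fun j => (Xbm _ (Xpsi j)).1) bsum.
have [x xP] : exists x : I -> T, forall t, key (x (key t)) = key t.
  have ex i : exists u : T, forall t, key t = i -> key u = i.
    have [[u ui]|no] := pselect (exists u, key u = i); first by exists u.
    by exists point => t ti; exfalso; apply: no; exists t.
  by have [x xP] := choice ex; exists x => t; exact: xP.
pose w i := fine (mu (key @^-1` [set i])).
have w0 i : 0 <= w i by rewrite fine_ge0.
have w1 : \sum_i w i = 1 by exact: sum_partition_mass.
pose k := (Num.truncn (2 * #|I|%:R * W / e1)).+1.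
exists k; set n := iter k _ m.
have kn : (k <= n)%N.
  rewrite /n; elim: (k) => [//|l IH] /=.
  have : (0 < iter l (fun n0 => n0 + n0) m)%N by elim: (l) => [//|l' IH'] /=; rewrite addn_gt0 IH'.
  by move: IH; lia.
have n0 : (0 < n)%N by apply: leq_trans kn.
have [z zP] := weights_rounding x n0 w0 w1.
exists z => f Xf f1.
have fW t : 0 <= `|f t| `^ p <= W.
  by rewrite powR_ge0/= (le_trans (Psi_nik f t Xf))// ler_piMr//; lra.
have f_le t : `|f t| <= W `^ p^-1.
  have [_ h] := andP (fW t).
  rewrite -[leLHS]powRr1// -(@divff _ p) ?gt_eqF// powRrM.
  by rewrite ge0_ler_powR ?nnegrE ?powR_ge0 ?invr_ge0 ?(ltW p0)//; lra.
have M0 : 0 < W `^ p^-1 by rewrite powR_gt0; lra.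
have osc t : `| `|f t| `^ p - `|f (x (key t))| `^ p| <= e1.
  set t' := x (key t).
  have -> : e1 = p * (K.+1%:R * tau) * (W `^ p^-1) `^ p.
    rewrite -powRrM mulVf ?gt_eqF// powRr1; last by lra.
    by rewrite /tau; field; rewrite !gt_eqF//; lra.
  apply: powR_lipschitz => //; rewrite ?normr_ge0 ?f_le//.
  apply: le_trans (ler_dist_dist _ _) _.
  have -> : f t - f t' = \sum_(j < K) f (y j) * (psi j t - psi j t').
    have [c ->] := phiX f Xf; set g := \sum_(i < N) _.
    have gE u : g u = \sum_(j < K) g (y j) * psi j u.
      by rewrite {1}(Xy c : g = _) fct_sumE.
    rewrite (gE t) (gE t') -sumrB.
    by apply: eq_bigr => j _; rewrite mulrBr.
  apply: le_trans (ler_norm_sum _ _ _) _.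
  apply: (@le_trans _ _ (\sum_(j < K) W `^ p^-1 * tau)).
    apply: ler_sum => j _; rewrite normrM; apply: ler_pM => //.
    by apply: okey; rewrite /t' xP.
  rewrite sumr_const card_ord -[leLHS]mulr_natl mulrCA [leRHS]mulrC.
  rewrite ler_wpM2l ?(ltW M0)// ler_wpM2r ?(ltW tau0)//.
  by rewrite ler_nat.
have h1 := mean_partition mkey (bounded_measurable_powR (ltW p0) (Xbm f Xf)) osc.
have h2 := zP (fun t => `|f t| `^ p) W (fun i => fW _).
have h3 : 2 * #|I|%:R * W / n%:R <= e1.
  rewrite ler_pdivrMr ?ltr0n// [leRHS]mulrC -ler_pdivrMr//.
  by rewrite (le_trans (ltW (truncnS_gt _)))// ler_nat.
apply: le_trans (ler_distD (\sum_i w i * `|f (x i)| `^ p) _ _) _.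
rewrite [leRHS](_ : eta = e1 + e1); last by rewrite /e1; lra.
apply: lerD; first exact: le_trans h2 h3.
by rewrite distrC.
Qed.
End probability_mean.

(** * Power means over a probability space *)

Section power_mean.
Variables (R : realType) (d : measure_display) (T : measurableType d).
Variable mu : probability T R.

Definition power_mean (p : R) (f : T -> R) : R :=
  Rintegral mu setT (fun x => `|f x| `^ p).

Lemma power_mean_ge0 p f : 0 <= power_mean p f.
Proof. by apply: Rintegral_ge0 => x _; exact: powR_ge0. Qed.

Lemma power_meanZ p c f : 0 <= p -> bounded_measurable f ->
  power_mean p (fun x => c * f x) = `|c| `^ p * power_mean p f.
Proof.
move=> p0 bf; rewrite /power_mean -meanZ; last exact: bounded_measurable_powR.
by apply: eq_Rintegral => x _; rewrite normrM powRM.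
Qed.

(** Jensen's inequality for the power [p / q] and the function [`|f| ^ q], from
    the tangent line of the power at the mean [c], which is Bernoulli's
    inequality. *)
Lemma power_mean_jensen (p q : R) f : 0 < q -> q <= p -> bounded_measurable f ->
  power_mean q f `^ (p / q) <= power_mean p f.
Proof.
move=> q0 qp bf; have p0 : 0 < p by lra.
set c := power_mean q f; have c0 : 0 <= c := power_mean_ge0 q f.
have [->|cn0] := eqVneq c 0.
  by rewrite powR0 ?power_mean_ge0// mulf_neq0 ?invr_neq0 ?gt_eqF.
have {}c0 : 0 < c by rewrite lt_neqAle eq_sym cn0.
pose r := p / q; have r1 : 1 <= r by rewrite ler_pdivlMr// mul1r.
have bq := bounded_measurable_powR (ltW q0) bf.
have bp := bounded_measurable_powR (ltW p0) bf.
have tangent x : c `^ r * (1 - r) + c `^ r * r / c * `|f x| `^ q <= `|f x| `^ p.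
  have -> : `|f x| `^ p = c `^ r * (`|f x| `^ q / c) `^ r.
    rewrite -powRM ?divr_ge0 ?powR_ge0 ?(ltW c0)// mulrCA divff ?gt_eqF// mulr1.
    by rewrite -powRrM /r mulrCA divff ?gt_eqF// mulr1.
  have := bernoulli_powR r1 (divr_ge0 (powR_ge0 `|f x| q) (ltW c0)).
  move/(ler_wpM2l (powR_ge0 c r)); apply: le_trans.
  by rewrite le_eqVlt; apply/orP; left; apply/eqP; ring.
have := le_mean mu (bounded_measurableD (bounded_measurable_cst _ _) (bounded_measurableZ _ bq))
  bp tangent.
rewrite meanD ?mean_cst ?meanZ//; first last.
- exact: bounded_measurableZ.
- exact: bounded_measurable_cst.
rewrite -/(power_mean q f) -/(power_mean p f) -/c; apply: le_trans.
by rewrite le_eqVlt; apply/orP; left; apply/eqP; field.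
Qed.

Lemma Lpnorm_power_mean p f : 0 < p -> bounded_measurable f ->
  Lpnorm mu p f = (power_mean p f `^ p^-1)%:E.
Proof.
move=> p0 bf; rewrite /Lpnorm unlock -poweR_EFin; congr (_ `^ _)%E.
have /integrable_fin_num : mu.-integrable setT (EFin \o (fun x => `|f x| `^ p)).
  exact/bounded_measurable_integrable/bounded_measurable_powR/bf/ltW.
move=> /(_ measurableT) fin; rewrite /power_mean /Rintegral fineK//.
Qed.

Lemma power_mean_nikolskii_functional (p W : R) (X : set (T -> R^o)) :
  2 <= p -> linear_subspace X -> (forall f, X f -> bounded_measurable f) ->
  (forall f x, X f -> `|f x| `^ p <= W * power_mean p f) ->
  nikolskii_functional p W X (power_mean p).
Proof.
move=> p2 Xsub Xbm XW; have p0 : 0 <= p by lra.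
split=> //; first by move=> u _; exact: power_mean_ge0.
move=> u v Xu Xv.
have Xuv : X (2^-1 *: (u - v)).
  apply: linear_subspace_midpoint => //; have [X0 Xlin] := Xsub.
  by rewrite -[- v]addr0 -scaleN1r; exact: Xlin.
have bm w : X w -> bounded_measurable (fun x => `|w x| `^ p).
  by move=> Xw; apply: bounded_measurable_powR => //; exact: Xbm.
have b1 := bm _ (linear_subspace_midpoint Xsub Xu Xv); have b2 := bm _ Xuv.
rewrite /power_mean -meanD// mulrC -meanD; [|exact: bm|exact: bm].
rewrite -meanZ; last by apply: bounded_measurableD; exact: bm.
apply: le_mean.
- exact: bounded_measurableD.
- by apply/bounded_measurableZ/bounded_measurableD; exact: bm.
by move=> x; have := clarkson (u x) (v x) p2; rewrite ![_ / 2]mulrC.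
Qed.

End power_mean.

(** Both sides are homogeneous of degree [p]. If [f] has mean zero, then [f]
    vanishes everywhere by the pointwise bound. *)
Lemma relative_error (R : realType) (d : measure_display) (T : measurableType d)
    (mu : probability T R) (p W eps : R) (X : set (T -> R^o)) (m : nat) (xi : 'I_m -> T) :
  0 < p -> 0 <= eps -> linear_subspace X -> (forall f, X f -> bounded_measurable f) ->
  (forall f x, X f -> `|f x| `^ p <= W * power_mean mu p f) ->
  (forall f, X f -> power_mean mu p f <= 1 ->
    `|m%:R^-1 * (\sum_i `|f (xi i)| `^ p) - power_mean mu p f| <= eps) ->
  forall f, X f ->
    `|m%:R^-1 * (\sum_i `|f (xi i)| `^ p) - power_mean mu p f| <= eps * power_mean mu p f.
Proof.
move=> p0 eps0 [X0 Xlin] Xbm XW H f Xf; set r := power_mean mu p f.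
have [r0|rn0] := eqVneq r 0.
  rewrite r0 mulr0 subr0 big1 ?mulr0 ?normr0// => i _.
  by apply/eqP; rewrite eq_le powR_ge0 andbT (le_trans (XW f _ Xf))// -/r r0 mulr0.
have r0 : 0 < r by rewrite lt_neqAle eq_sym rn0 power_mean_ge0.
pose c := r `^ - p^-1; have c0 : 0 < c by rewrite powR_gt0.
have cp : `|c| `^ p = r^-1.
  by rewrite gtr0_norm// /c -powRrM mulNr mulVf ?gt_eqF// powR_inv1// ltW.
have Xcf : X (c *: f) by rewrite -[_ *: _]addr0; exact: Xlin.
have mE : power_mean mu p (c *: f) = 1.
  rewrite (_ : c *: f = (fun x => c * f x))//.
  by rewrite power_meanZ ?(ltW p0)//; [rewrite cp mulVf|exact: Xbm].
have := H _ Xcf; rewrite mE => /(_ (lexx _)).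
have -> : \sum_i `|(c *: f) (xi i)| `^ p = r^-1 * \sum_i `|f (xi i)| `^ p.
  rewrite mulr_sumr; apply: eq_bigr => i _.
  by rewrite -cp -powRM// -normrM.
rewrite (_ : _ - 1 = (m%:R^-1 * (\sum_i `|f (xi i)| `^ p) - r) / r); last first.
  by move: (\sum_i _) (m%:R^-1) => S n; field.
by rewrite normrM [`|r^-1|]gtr0_norm ?invr_gt0// ler_pdivrMr.
Qed.

(** Compactness of [Om] as a subset is used through the extension of [f] by
    zero, which is continuous on [Om] with its subspace topology. *)
Lemma continuous_bounded_measurable (R : realType) (V : topologicalType)
    (Om : set V) (x0 : Om) (f : subset_at x0 -> R^o) :
  compact Om -> continuous f ->
  bounded_measurable (f : borel (subset_at x0) -> R).
Proof.
move=> cOm cf; split.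
  apply: (measurability _ (RGenOInfty.measurableE R)) => //.
  move=> /= _ [_ [a ->] <-]; rewrite setTI; apply: sub_sigma_algebra.
  by move/continuousP : cf; apply; exact: interval_open.
have /subspace_valL_continuousP' := cf => /(_ 0) wf.
have /compact_bounded := continuous_compact wf cOm.
move=> [M [_ MP]]; exists (M + 1) => x.
apply: (MP (M + 1)); first by rewrite ltrDl.
exists (val x); first exact: set_valP.
by have := valLK (0 : R^o) (f : Om -> R^o) => h; rewrite -[in RHS]h.
Qed.

(** * The discretization theorem *)

Lemma norm_le_supnorm (R : realType) (T : Type) (f : T -> R) (b : R) (x : T) :
  (forall y, `|f y| <= b) -> `|f x| <= supnorm f.
Proof.
move=> fb; apply: ub_le_sup; last by exists x.
by exists b => _ [y _ <-]; exact: fb.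
Qed.

(** With [W = B ^ p * N ^ (p / q)] one has [ln W <= p * (ln B + ln N)], and
    [log2 (2 * B * N)] is at least [1 + ln B + ln N] as [ln 2 <= 1]. *)
Lemma log_weight_le (R : realType) (p q B : R) (N : nat) :
  2 <= q -> q <= p -> 1 <= B -> (0 < N)%N ->
  [/\ 1 <= B `^ p * N%:R `^ (p / q), 1 <= log2 (2 * B * N%:R) &
    1 + ln (B `^ p * N%:R `^ (p / q)) <= (1 + p) * log2 (2 * B * N%:R)].
Proof.
move=> q2 qp B1 N0; have N1 : 1 <= N%:R :> R by rewrite ler1n.
have pq : 1 <= p / q <= p.
  rewrite ler_pdivlMr ?mul1r ?qp/=; last by lra.
  by rewrite ler_pdivrMr; [nra|lra].
have B0 : 0 < B by lra.
have NR0 : 0 < N%:R :> R by lra.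
have lB : 0 <= ln B by rewrite ln_ge0.
have lN : 0 <= ln N%:R :> R by rewrite ln_ge0.
have l2 : 0 < ln 2 :> R by rewrite ln_gt0// ltr1n.
have l21 : ln 2 <= 1 :> R.
  by have := le_ln1Dx (_ : -1 < 1 :> R); rewrite (_ : 1 + 1 = 2 :> R)//; apply; lra.
have logE : 1 + ln B + ln N%:R <= log2 (2 * B * N%:R).
  rewrite /log2 !lnM ?posrE ?mulr_gt0// ler_pdivlMr//; nra.
split; [|lra|].
  apply: mulr_ege1.
    by rewrite -[leLHS](powRr0 B); apply: ler_powR => //; lra.
  by rewrite -[leLHS](powRr0 N%:R); apply: ler_powR => //; lra.
rewrite lnM ?posrE ?powR_gt0// !ln_powR.
apply: (@le_trans _ _ ((1 + p) * (1 + ln B + ln N%:R))); last by rewrite ler_wpM2l//; lra.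
have : p / q * ln N%:R <= p * ln N%:R by rewrite ler_wpM2r//; case/andP: pq.
nra.
Qed.

Unset Implicit Arguments.

Theorem corollary2p2 (R : realType) (p q eps : R) :
  2 <= q -> q <= p -> 0 < eps -> eps < 1 ->
  exists2 C : R, 0 < C &
  forall (d : nat) (Om : set 'rV[R]_d) (x0 : Om)
    (mu : probability (borel (subset_at x0)) R)
    (N : nat) (X : set (subset_at x0 -> R^o)) (B : R),
  compact Om ->
  (0 < N)%N ->
  linear_subspace X -> has_dim X N ->
  (forall f, X f -> continuous f) ->
  1 <= B ->
  (forall f, X f ->
    ((supnorm f)%:E <= (B * N%:R `^ q^-1)%:E * Lpnorm mu q f)%E) ->
  exists (m : nat) (xi : 'I_m -> Om),
    [/\ (0 < m)%N,
        m%:R <= C * B `^ p * N%:R `^ (p / q) * log2 (2 * B * N%:R) ^+ 3 &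
        forall f, X f ->
          (((1 - eps)%:E * (Lpnorm mu p f `^ p)
             <= (m%:R^-1 * \sum_(j < m) `|f (xi j)| `^ p)%:E)%E
          /\
          ((m%:R^-1 * \sum_(j < m) `|f (xi j)| `^ p)%:E
             <= (1 + eps)%:E * (Lpnorm mu p f `^ p))%E)].
Proof.
move=> q2 qp eps0 eps1.
have p2 : 2 <= p by lra.
have p0 : 0 < p by lra.
have p1 : 1 <= p by lra.
have q0 : 0 < q by lra.
have he0 : 0 < eps / 2 by rewrite divr_gt0.
have he1 : eps / 2 <= 1 by lra.
have [C1 C11 selectP] := subsampling p2 he0 he1.
have C10 : 0 < C1 by lra.
exists (2 * C1 * (1 + p) ^+ 3); first by rewrite mulr_gt0 ?exprn_gt0 ?mulr_gt0//; lra.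
move=> d Om x0 mu N X B cOm N0 Xsub [phi [Xphi _ phiX]] Xcont B1 Xsup.
have bm f : X f -> bounded_measurable (f : borel (subset_at x0) -> R).
  by move=> /Xcont; exact: continuous_bounded_measurable.
set W := B `^ p * N%:R `^ (p / q).
have [W1 La1 WLa] := log_weight_le q2 qp B1 N0; rewrite -/W in W1 WLa.
have XW f x : X f -> `|f x| `^ p <= W * power_mean mu p f.
  move=> Xf; have [_ [b fb]] := bm f Xf.
  have := Xsup f Xf; rewrite Lpnorm_power_mean//; last exact: bm.
  rewrite -EFinM lee_fin => /(le_trans (norm_le_supnorm x fb)) fx.
  have BN0 : 0 <= B * N%:R `^ q^-1 by rewrite mulr_ge0 ?powR_ge0//; lra.
  apply: (@le_trans _ _ (W * power_mean mu q f `^ (p / q))); last first.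
    by apply: ler_wpM2l; [lra|exact/power_mean_jensen/bm].
  have -> : W * power_mean mu q f `^ (p / q) =
     (B * N%:R `^ q^-1 * power_mean mu q f `^ q^-1) `^ p.
    rewrite !powRM ?powR_ge0 ?mulr_ge0 ?powR_ge0//; try lra.
    by rewrite -!powRrM [q^-1 * p]mulrC.
  by apply: ge0_ler_powR; rewrite ?nnegrE ?(ltW p0)// mulr_ge0 ?powR_ge0.
have nik := @power_mean_nikolskii_functional R _ (borel (subset_at x0)) mu p W X
  p2 Xsub bm XW.
pose n := C1 * (W * (1 + ln W) ^+ 3).
pose m := (Num.truncn n).+1.
have lW : 0 <= ln W by rewrite ln_ge0.
have l3 : 1 <= (1 + ln W) ^+ 3 by rewrite exprn_ege1//; lra.
have n1 : 1 <= n by do 2 apply: mulr_ege1 => //.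
have nm : n <= m%:R by rewrite ltW// truncnS_gt.
have mn : m%:R <= 2 * n.
  have : m%:R <= n + 1 by rewrite /m -[_.+1%:R]natr1 lerD2r truncn_le; lra.
  by lra.
have [k [z zP]] := @uniform_quadrature R _ (borel (subset_at x0)) mu p W _ X N phi m
  p1 W1 he0 (ltn0Sn (Num.truncn n)) Xsub Xphi phiX bm XW.
have [|xi] := selectP _ W X _ nik W1 m k z (eps / 2) nm _ zP; first by lra.
rewrite (_ : eps / 2 + eps / 2 = eps); last by lra.
move=> xiP.
have rel := @relative_error R _ (borel (subset_at x0)) mu p W eps X m xi
  p0 (ltW eps0) Xsub bm XW xiP.
exists m, xi; split=> // [|f Xf].
  apply: le_trans mn _.
  have La0 : 0 <= log2 (2 * B * N%:R) by lra.
  have h : (1 + ln W) ^+ 3 <= (1 + p) ^+ 3 * log2 (2 * B * N%:R) ^+ 3.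
    by rewrite -exprMn; apply: lerXn2r => //; rewrite nnegrE; [lra|apply: mulr_ge0; lra].
  have CW : 0 <= 2 * C1 * W by apply: mulr_ge0; lra.
  have := ler_wpM2l CW h; rewrite /n -/W.
  by rewrite (_ : 2 * C1 * (1 + p) ^+ 3 * B `^ p * N%:R `^ (p / q) =
     2 * C1 * W * (1 + p) ^+ 3) ?/W; [lra|ring].
have -> : (Lpnorm mu p f `^ p)%E = (power_mean mu p f)%:E.
  rewrite Lpnorm_power_mean//; last exact: bm.
  by rewrite poweR_EFin -powRrM mulVf ?gt_eqF// powRr1// power_mean_ge0.
rewrite -!EFinM !lee_fin.
have := rel f Xf; rewrite ler_norml => /andP[h1 h2].
by split; lra.
Qed.
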